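(* Let $N\ge 1$, $r\ge 2$, and let $(\rho_k)_{k\in\mathbf N}$ be a diverging sequence of representations $\rho_k:\mathbf F_r\to \mathrm{Isom}\,\mathbf H^N$ with minimal joint displacements $r_k$. Fix a non-principal ultrafilter $\omega$ on $\mathbf N$ and let $\rho_\infty$ be the limit action of $\mathbf F_r$ on the minimal tree $T$. Assume that $\rho_\infty:\mathbf F_r\to\mathrm{Isom}\,T$ is Schottky. Then, up to passing to a subsequence (i.e. for $k$ ranging over some infinite subset of $\mathbf N$), $$\lim_k\; r_k\cdot \mathrm{Hdim}\,\Lambda_{\rho_k}=\mathrm{Hdim}\,\Lambda_{\rho_\infty}.$$
   Context: $\mathbf F_r$ is the free group on generators $S=\{s_1,\dots,s_r\}$ with word length $|\cdot|$; $(\mathbf H^N,d)$ is real hyperbolic space. Diverging sequences and limit trees. The minimal joint displacement of $\rho_k$ is $r_k:=\inf_{x\in\mathbf H^N}\max_{s\in S}d(x,\rho_k(s)x)$, and $(\rho_k)$ is diverging if $r_k\to+\infty$. Choose $o_k\in\mathbf H^N$ with $\max_{s\in S}d(o_k,\rho_k(s)o_k)\le r_k+1$. The asymptotic cone $(X_\omega,d_\omega,o_\omega)$ of $X_k=(\mathbf H^N,r_k^{-1}d,o_k)$ is the set of sequences $(x_k)$ in $\mathbf H^N$ with $\omega\text{-}\lim r_k^{-1}d(x_k,o_k)<\infty$, modulo $(x_k)\sim(y_k)$ iff $\omega\text{-}\lim r_k^{-1}d(x_k,y_k)=0$, with $d_\omega([(x_k)],[(y_k)])=\omega\text{-}\lim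 r_k^{-1}d(x_k,y_k)$ and $o_\omega=[(o_k)]$. It is a real tree, on which $\mathbf F_r$ acts isometrically by $\gamma\cdot[(x_k)]=[(\rho_k(\gamma)x_k)]$. It contains a unique minimal closed convex invariant subtree $T$ (the union of the axes of the hyperbolic elements), which is separable and pointed at $o_\omega$; $\rho_\infty:\mathbf F_r\to\mathrm{Isom}\,T$ denotes the resulting action. Schottky. For a complete pointed $\mathrm{CAT}(-1)$-space $(X,d,o)$, a representation $\rho:\mathbf F_r\to\mathrm{Isom}\,X$ is Schottky if for some $K\ge 1$ the orbit map $\gamma\mapsto\rho(\gamma)o$ is a $K$-quasi-isometric embedding: $\frac1K|\gamma^{-1}\gamma'|-K\le d(\rho(\gamma)o,\rho(\gamma')o)\le K|\gamma^{-1}\gamma'|+K$. Limit sets. The limit set $\Lambda_\rho\subset\partial X$ is the set of accumulation points in the boundary $\partial X$ of the orbit of $o$ (for Schottky $\rho$ it is the image of $\partial\mathbf F_r$ under the continuous extension of the orbit map). $\mathrm{Hdim}$ is the Hausdorff dimension for the visual distance $d_o(\xi,\zeta)=e^{-\langle\xi,\zeta\rangle_o}$ on $\partial X$, where $\langle x,y\rangle_o=\frac12(d(x,o)+d(y,o)-d(x,y))$ is the Gromov product extended continuously to $\partial X$. This is used with $X=\mathbf H^N$ (metric $d$) for $\rho_k$, and with $X=T$ (metric $d_\omega$) for $\rho_\infty$. *)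

(* Defs.v *)
From HB Require Import structures.
From mathcomp Require Import all_boot all_order all_algebra.
From mathcomp Require Import all_classical all_reals all_analysis.
From mathcomp Require Import ring lra.

Set Implicit Arguments.
Unset Strict Implicit.
Unset Printing Implicit Defensive.

Import Order.TTheory GRing.Theory Num.Theory.
Import numFieldNormedType.Exports.

Local Open Scope classical_set_scope.
Local Open Scope ring_scope.

(* The free group on r generators as the group of reduced words; the letter
   (i, true) is the generator s_i and (i, false) is its inverse. *)
Section FreeGroup.
Variable r : nat.

Definition letter : Type := ('I_r * bool)%type.
Definition letter_inv (a : letter) : letter := (a.1, ~~ a.2).
Definition reduced (w : seq letter) : bool :=
  sorted [rel a b | b != letter_inv a] w.

Record free_group : Type := FreeGroup {
  fg_word :> seq letter;
  fg_reduced : reduced fg_word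
}.

HB.instance Definition _ := [isSub for fg_word].
HB.instance Definition _ := [Choice of free_group by <:].

Lemma letter_invK : involutive letter_inv.
Proof. by case=> i b; rewrite /letter_inv /= negbK. Qed.

Definition push (a : letter) (w : seq letter) : seq letter :=
  if w is b :: w' then if b == letter_inv a then w' else a :: w else [:: a].

Lemma reduced_push a w : reduced w -> reduced (push a w).
Proof.
case: w => //= b w redw; case: ifP => [_|/negbT nab]; first exact: path_sorted redw.
by rewrite /reduced /= nab.
Qed.

Lemma reduced_push_id a w : reduced (a :: w) -> push a w = a :: w.
Proof. by case: w => //= b w /andP[/negbTE->]. Qed.

Lemma pushK a w : reduced w -> push a (push (letter_inv a) w) = w.
Proof.
case: w => [|b w] /=; first by rewrite eqxx.
rewrite letter_invK; case: eqP => [->|_ _ /=]; first exact: reduced_push_id.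
by rewrite eqxx.
Qed.

Lemma reduced_foldr u v : reduced v -> reduced (foldr push v u).
Proof. by move=> rv; elim: u => //= a u; apply: reduced_push. Qed.

Lemma foldr_push a u v : reduced v ->
  foldr push v (push a u) = push a (foldr push v u).
Proof.
case: u => //= b u rv; case: eqP => [->|//].
by rewrite pushK ?reduced_foldr.
Qed.

Lemma foldr_pushA u v w : reduced w ->
  foldr push w (foldr push v u) = foldr push (foldr push w v) u.
Proof. by move=> rw; elim: u => //= a u IHu; rewrite foldr_push ?IHu. Qed.

Lemma foldr_push_nil u : reduced u -> foldr push [::] u = u.
Proof.
by elim: u => //= a u IHu ru; rewrite IHu ?reduced_push_id //; apply: path_sorted ru.
Qed.

Definition word_inv (w : seq letter) : seq letter := rev (map letter_inv w).

Lemma reduced_inv w : reduced w -> reduced (word_inv w).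
Proof.
rewrite /reduced /word_inv rev_sorted sorted_map; apply: sub_sorted => a b /=.
by rewrite letter_invK eq_sym => /contra_neq; apply.
Qed.

Lemma word_invK : involutive word_inv.
Proof.
move=> w; rewrite /word_inv map_rev revK -map_comp -[RHS]map_id.
by apply: eq_map => a /=; rewrite letter_invK.
Qed.

Lemma foldr_inv w : foldr push w (word_inv w) = [::].
Proof.
elim: w => //= a w IHw.
by rewrite /word_inv /= rev_cons foldr_rcons /= letter_invK eqxx.
Qed.

Definition fg_one : free_group := @FreeGroup [::] isT.
Definition fg_mul (u v : free_group) : free_group :=
  FreeGroup (reduced_foldr u (fg_reduced v)).
Definition fg_inv (u : free_group) : free_group :=
  FreeGroup (reduced_inv (fg_reduced u)).

Lemma fg_mulA : associative fg_mul.
Proof. by move=> u v w; apply/val_inj; rewrite /= foldr_pushA ?fg_reduced. Qed.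

Lemma fg_mul1 : left_id fg_one fg_mul.
Proof. by move=> u; apply/val_inj. Qed.

Lemma fg_mulr1 : right_id fg_one fg_mul.
Proof. by move=> u; apply/val_inj; rewrite /= foldr_push_nil ?fg_reduced. Qed.

Lemma fg_mulV : left_inverse fg_one fg_inv fg_mul.
Proof. by move=> u; apply/val_inj; rewrite /= foldr_inv. Qed.

Lemma fg_mulrV : right_inverse fg_one fg_inv fg_mul.
Proof.
by move=> u; apply/val_inj; have /= := foldr_inv (word_inv u); rewrite word_invK.
Qed.

HB.instance Definition _ :=
  isGroup.Build free_group fg_mulA fg_mul1 fg_mulr1 fg_mulV fg_mulrV.

Definition word_length (g : free_group) : nat := size g.

Definition gen (i : 'I_r) : free_group := @FreeGroup [:: (i, true)] isT.

End FreeGroup.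

(* Hyperboloid model of real hyperbolic space; the time coordinate is ord0. *)
Section Hyperbolic.
Variables (R : realType) (N : nat).
Implicit Types x y z u v : 'rV[R]_N.+1.

Definition spatial x y : R :=
  \sum_(i < N) x ord0 (lift ord0 i) * y ord0 (lift ord0 i).

Definition lorentz x y : R := spatial x y - x ord0 ord0 * y ord0 ord0.

Record hyp : Type := Hyp {
  hyp_val :> 'rV[R]_N.+1;
  hypP : (lorentz hyp_val hyp_val == -1) && (0 < hyp_val ord0 ord0)
}.

HB.instance Definition _ := [isSub for hyp_val].
HB.instance Definition _ := [Choice of hyp by <:].

Definition arcosh (t : R) : R := ln (t + Num.sqrt (t ^+ 2 - 1)).

Definition hyp_dist (x y : hyp) : R := arcosh (- lorentz x y).

Lemma spatialC x y : spatial x y = spatial y x.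
Proof. by apply: eq_bigr => i _; rewrite mulrC. Qed.

Lemma lorentzC x y : lorentz x y = lorentz y x.
Proof. by rewrite /lorentz spatialC mulrC. Qed.

Lemma spatialBl (a b : R) x y z :
  spatial (a *: x - b *: y) z = a * spatial x z - b * spatial y z.
Proof.
rewrite /spatial !mulr_sumr -sumrB; apply: eq_bigr => i _.
by rewrite !mxE mulrBl !mulrA.
Qed.

Lemma lorentzBl (a b : R) x y z :
  lorentz (a *: x - b *: y) z = a * lorentz x z - b * lorentz y z.
Proof. by rewrite /lorentz spatialBl !mxE; ring. Qed.

Lemma lorentzBr (a b : R) x y z :
  lorentz z (a *: x - b *: y) = a * lorentz z x - b * lorentz z y.
Proof. by rewrite ![lorentz z _]lorentzC lorentzBl. Qed.

Lemma spatial_ge0 x : 0 <= spatial x x.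
Proof. by apply: sumr_ge0 => i _; rewrite -expr2 sqr_ge0. Qed.

Lemma spatial_eq0 x i : spatial x x = 0 -> x ord0 (lift ord0 i) = 0.
Proof.
move/eqP; rewrite /spatial psumr_eq0 => [/allP/(_ i (mem_index_enum i))|j _].
  by rewrite /= mulf_eq0 orbb => /eqP.
by rewrite -expr2 sqr_ge0.
Qed.

Lemma hyp_gt0 (x : hyp) : 0 < x ord0 ord0.
Proof. by case/andP: (hypP x). Qed.

Lemma hyp_lorentz (x : hyp) : lorentz x x = -1.
Proof. by case/andP: (hypP x) => /eqP. Qed.

Lemma lorentz_orth (y : hyp) u : lorentz u y = 0 ->
  exists2 l : R, u ord0 ord0 = l * y ord0 ord0
   & lorentz u u = spatial (1 *: u - l *: hyp_val y) (1 *: u - l *: hyp_val y)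
       + l ^+ 2.
Proof.
move=> uy; have y0 := hyp_gt0 y; have yy := hyp_lorentz y.
exists (u ord0 ord0 / y ord0 ord0); first by rewrite divfK ?gt_eqF.
have uyE : spatial u y = u ord0 ord0 * y ord0 ord0.
  by apply/eqP; rewrite -subr_eq0; apply/eqP.
have yyE : spatial y y = y ord0 ord0 ^+ 2 - 1.
  by rewrite expr2 -yy /lorentz; ring.
rewrite spatialBl ![spatial _ (_ - _)]spatialC !spatialBl (spatialC y u) uyE yyE.
by rewrite /lorentz; field; rewrite gt_eqF.
Qed.

Lemma lorentz_orth_ge0 (y : hyp) u : lorentz u y = 0 -> 0 <= lorentz u u.
Proof. by case/lorentz_orth => l _ ->; rewrite addr_ge0 ?spatial_ge0 ?sqr_ge0. Qed.

Lemma lorentz_orth_eq0 (y : hyp) u :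
  lorentz u y = 0 -> lorentz u u = 0 -> u = 0.
Proof.
case/lorentz_orth => l u0 ->; move/eqP.
rewrite paddr_eq0 ?spatial_ge0 ?sqr_ge0 // sqrf_eq0 => /andP[/eqP sp0 /eqP l0].
apply/rowP => j; rewrite mxE; case: (unliftP ord0 j) => [i|] -> ; last first.
  by rewrite u0 l0 mul0r.
by have := spatial_eq0 i sp0; rewrite !mxE l0 mul0r subr0 mul1r.
Qed.

Lemma hyp_pos (x y : hyp) : 0 < - lorentz x y.
Proof.
have := spatial_ge0 (y ord0 ord0 *: hyp_val x - x ord0 ord0 *: hyp_val y).
have sqE (z : hyp) : spatial z z = z ord0 ord0 ^+ 2 - 1.
  by rewrite expr2 -(hyp_lorentz z) /lorentz; ring.
rewrite spatialBl ![spatial _ (_ - _)]spatialC !spatialBl !sqE (spatialC y x).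
rewrite /lorentz; move: (hyp_gt0 x) (hyp_gt0 y).
set a := (hyp_val x) _ _; set b := (hyp_val y) _ _; set s := spatial _ _.
move=> a0 b0 h; have ab0 : 0 < a * b by rewrite mulr_gt0.
rewrite opprB subr_gt0 -(ltr_pM2l ab0).
have a20 : 0 < a ^+ 2 by rewrite exprn_gt0.
have b20 : 0 < b ^+ 2 by rewrite exprn_gt0.
nra.
Qed.

Lemma hyp_ge1 (x y : hyp) : 1 <= - lorentz x y.
Proof.
have o : lorentz (1 *: hyp_val x - (- lorentz x y) *: hyp_val y) y = 0.
  by rewrite lorentzBl hyp_lorentz; ring.
have := lorentz_orth_ge0 o.
rewrite lorentzBl !lorentzBr !hyp_lorentz (lorentzC y x).
by have := hyp_pos x y; set a := lorentz _ _ => a0 h; nra.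
Qed.

Lemma arcosh_arg (t : R) : 1 <= t -> 1 <= t + Num.sqrt (t ^+ 2 - 1).
Proof. by move=> t1; rewrite ler_wpDr ?sqrtr_ge0. Qed.

Lemma hyp_dist_refl (x : hyp) : hyp_dist x x = 0.
Proof.
by rewrite /hyp_dist /arcosh hyp_lorentz opprK expr1n subrr sqrtr0 addr0 ln1.
Qed.

Lemma hyp_dist_sym (x y : hyp) : hyp_dist x y = hyp_dist y x.
Proof. by rewrite /hyp_dist lorentzC. Qed.

Lemma hyp_dist_eq0 (x y : hyp) : hyp_dist x y = 0 -> x = y.
Proof.
rewrite /hyp_dist /arcosh => /eqP; rewrite ln_eq0; last first.
  by apply: lt_le_trans (arcosh_arg (hyp_ge1 x y)).
move/eqP=> e; have a1 := hyp_ge1 x y.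
have l1 : lorentz x y = -1.
  by have := sqrtr_ge0 ((- lorentz x y) ^+ 2 - 1); lra.
have : 1 *: hyp_val x - 1 *: hyp_val y = 0.
  apply: (@lorentz_orth_eq0 y); first by rewrite lorentzBl l1 hyp_lorentz; ring.
  by rewrite lorentzBl !lorentzBr !hyp_lorentz (lorentzC y x) l1; ring.
by rewrite !scale1r => /eqP; rewrite subr_eq0 => /eqP/val_inj.
Qed.

Lemma lorentz_CS (y : hyp) u v : lorentz u y = 0 -> lorentz v y = 0 ->
  lorentz u v ^+ 2 <= lorentz u u * lorentz v v.
Proof.
move=> uy vy; set A := lorentz u u; set B := lorentz v v; set C := lorentz u v.
have B0 : 0 <= B by apply: lorentz_orth_ge0 vy.
have [B00|Bn0] := eqVneq B 0.
  have v0 : v = 0 by apply: lorentz_orth_eq0 vy B00.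
  have -> : C = 0.
    rewrite /C v0 /lorentz /spatial mxE mulr0 subr0 big1 // => i _.
    by rewrite mxE mulr0.
  by rewrite B00 mulr0 expr0n.
have {}Bn0 : 0 < B by rewrite lt_neqAle eq_sym Bn0.
have o : lorentz (B *: u - C *: v) y = 0 by rewrite lorentzBl uy vy !mulr0 subrr.
have := lorentz_orth_ge0 o; rewrite lorentzBl !lorentzBr (lorentzC v u).
rewrite -/A -/B -/C => h; rewrite -(ler_pM2l Bn0) -subr_ge0.
by apply: le_trans h _; rewrite le_eqVlt; apply/orP; left; apply/eqP; ring.
Qed.

Lemma hyp_dist_triangle (y x z : hyp) : hyp_dist x z <= hyp_dist x y + hyp_dist y z.
Proof.
rewrite /hyp_dist /arcosh.
have := @lorentz_CS y (1 *: hyp_val x - (- lorentz x y) *: hyp_val y)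
  (1 *: hyp_val z - (- lorentz y z) *: hyp_val y).
have a1 := hyp_ge1 x y; have b1 := hyp_ge1 y z; have c1 := hyp_ge1 x z.
rewrite !lorentzBl !lorentzBr !hyp_lorentz (lorentzC z y) (lorentzC y x).
move: a1 b1 c1; set a := - lorentz x y; set b := - lorentz y z.
set c := - lorentz x z => a1 b1 c1.
have -> : lorentz x y = - a by rewrite opprK.
have -> : lorentz y z = - b by rewrite opprK.
have -> : lorentz x z = - c by rewrite opprK.
move=> /(_ ltac:(ring) ltac:(ring)) cs.
pose s := Num.sqrt (a ^+ 2 - 1); pose t := Num.sqrt (b ^+ 2 - 1).
have s0 : 0 <= s by apply: sqrtr_ge0.
have t0 : 0 <= t by apply: sqrtr_ge0.
have s2 : s ^+ 2 = a ^+ 2 - 1 by rewrite sqr_sqrtr // subr_ge0 exprn_ege1.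
have t2 : t ^+ 2 = b ^+ 2 - 1 by rewrite sqr_sqrtr // subr_ge0 exprn_ege1.
rewrite -/s -/t -lnM ?posrE; [|lra|lra].
have cm : c <= a * b + s * t.
  rewrite -lerBlDl; have [neg|pos] := lerP (c - a * b) 0.
    by rewrite (le_trans neg) ?mulr_ge0.
  rewrite -(@ler_pXn2r _ 2) ?nnegrE ?mulr_ge0 ?(ltW pos) //.
  rewrite exprMn s2 t2; apply: le_trans (le_trans _ cs) _.
    by rewrite le_eqVlt; apply/orP; left; apply/eqP; ring.
  by rewrite le_eqVlt; apply/orP; left; apply/eqP; ring.
have m2 : (a * t + b * s) ^+ 2 = (a * b + s * t) ^+ 2 - 1.
  rewrite [LHS](_ : _ = a ^+ 2 * t ^+ 2 + b ^+ 2 * s ^+ 2 + 2 * a * b * s * t);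
    last ring.
  rewrite [RHS](_ : _ = a ^+ 2 * b ^+ 2 + s ^+ 2 * t ^+ 2 + 2 * a * b * s * t - 1);
    last ring.
  by rewrite s2 t2; ring.
have at0 : 0 <= a * t + b * s by rewrite addr_ge0 // mulr_ge0 //; lra.
have sc : Num.sqrt (c ^+ 2 - 1) <= a * t + b * s.
  have -> : a * t + b * s = Num.sqrt ((a * t + b * s) ^+ 2).
    by rewrite sqrtr_sqr ger0_norm.
  rewrite ler_wsqrtr // m2 lerD2r ler_pXn2r ?nnegrE //; first lra.
  by apply: le_trans cm; lra.
rewrite ler_ln ?posrE; first nra.
  by apply: lt_le_trans (arcosh_arg c1).
by apply: mulr_gt0; lra.
Qed.

HB.instance Definition _ := @isMetric.Build R hyp hyp_dist hyp_dist_refl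
  hyp_dist_eq0 hyp_dist_sym hyp_dist_triangle.

End Hyperbolic.

(* A homomorphism from the free group to the isometry group of X, curried;
   each rep g is bijective, with inverse rep g^-1. *)
Record isom_rep (R : realType) (r : nat) (X : metricType R) := IsomRep {
  rep_fun :> free_group r -> X -> X;
  rep1 : forall x, rep_fun 1%g x = x;
  repM : forall g h x, rep_fun (g * h)%g x = rep_fun g (rep_fun h x);
  rep_isom : forall g x y, mdist (rep_fun g x) (rep_fun g y) = mdist x y
}.

Section Displacement.
Variables (R : realType) (r : nat) (X : metricType R) (rho : isom_rep r X).

Definition joint_disp (x : X) : R :=
  \big[Num.max/0]_(i < r) mdist x (rho (gen i) x).

Definition min_disp : R := inf (range joint_disp).

Lemma joint_disp_ge0 x : 0 <= joint_disp x.
Proof. exact: bigmax_ge_id. Qed.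

Lemma min_disp_ge0 : 0 <= min_disp.
Proof.
rewrite /min_disp; have [->|/set0P ne] := eqVneq (range joint_disp) set0.
  by rewrite inf0.
by apply: lb_le_inf => // _ [x _ <-]; apply: joint_disp_ge0.
Qed.

End Displacement.

Definition diverging (R : realType) (r : nat) (X : metricType R)
    (rho : nat -> isom_rep r X) : Prop :=
  min_disp (rho k) @[k --> \oo] --> +oo.

Definition nonprincipal (omega : set_system nat) : Prop :=
  forall n, ~ omega [set n].

Section Ultra.
Variables (R : realType) (omega : set_system nat).
Hypothesis UF : UltraFilter omega.

Lemma ultra_fmap (T : Type) (u : nat -> T) : UltraFilter (u @ omega).
Proof.
split; first exact: fmap_proper_filter.
move=> G PG sG; apply/seteqP; split=> // A GA.
have [//|UA] := in_ultra_setVsetC (u @^-1` A) UF.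
have GCA : G (~` A) by apply: sG.
have [] := filter_ex (filterI GA GCA).
by move=> t [].
Qed.

Lemma ultra_bounded_cvg (u : nat -> R) (M : R) :
  (forall k, 0 <= u k) -> (\forall k \near omega, u k <= M) -> cvg (u @ omega).
Proof.
move=> u0 uM; have := @segment_compact R 0 M.
rewrite compact_ultra => /(_ (u @ omega) (ultra_fmap u)) [|l [_ ul]].
  by rewrite /fmap /=; near=> k; rewrite /= in_itv /= u0 /=; near: k.
by apply/cvg_ex; exists l.
Unshelve. all: by end_near. Qed.

Lemma nonprincipal_oo : nonprincipal omega -> \oo `<=` omega.
Proof.
move=> np A [n _ nA].
have : omega [set k | (n <= k)%N].
  elim: {nA} n => [|n IHn]; first by apply: filterS filterT => k.
  have [/np//|nn] := in_ultra_setVsetC [set n] UF.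
  by apply: filterS (filterI IHn nn) => k /= [nk /eqP]; rewrite ltn_neqAle eq_sym => ->.
by apply: filterS => k /nA.
Qed.

End Ultra.

(* Asymptotic cone of the pointed spaces (X, r_k^-1 d, o_k), r_k being the
   minimal joint displacement of rho k *)
Section Cone.
Variables (R : realType) (r : nat) (X : metricType R).
Variables (rho : nat -> isom_rep r X) (o : nat -> X).
Variables (omega : set_system nat) (UF : UltraFilter omega).

Definition rdist (k : nat) (x y : X) : R := (min_disp (rho k))^-1 * mdist x y.

Lemma rdist_ge0 k x y : 0 <= rdist k x y.
Proof. by rewrite mulr_ge0 ?invr_ge0 ?min_disp_ge0 ?mdist_ge0. Qed.

Lemma rdistxx k x : rdist k x x = 0.
Proof. by rewrite /rdist mdistxx mulr0. Qed.

Lemma rdistC k x y : rdist k x y = rdist k y x.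
Proof. by rewrite /rdist metric_sym. Qed.

Lemma rdist_triangle k y x z : rdist k x z <= rdist k x y + rdist k y z.
Proof. by rewrite -mulrDr ler_wpM2l ?invr_ge0 ?min_disp_ge0 ?metric_triangle. Qed.

(* The omega-limit in [0, +oo] always exists, so it is finite exactly when the
   sequence converges in R along omega. *)
Definition admissible (x : nat -> X) : Prop :=
  cvg (rdist k (x k) (o k) @[k --> omega]).

Definition cone_seq : Type := {x : nat -> X | `[< admissible x >]}.
HB.instance Definition _ := Choice.on cone_seq.

Definition seq_dist (x y : nat -> X) : R :=
  lim (rdist k (x k) (y k) @[k --> omega]).

Lemma admissibleP x : admissible x <->
  exists M, \forall k \near omega, rdist k (x k) (o k) <= M.
Proof.
split=> [/cvg_ex[/= l xl]|[M xM]]; last first.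
  by apply: ultra_bounded_cvg xM => // k; apply: rdist_ge0.
exists (l + 1); have /cvgrPdist_le/(_ 1 ltr01) := xl.
by apply: filterS => k; rewrite distrC ler_distl => /andP[_].
Qed.

Lemma admissible_cvg (x y : cone_seq) :
  cvg (rdist k (val x k) (val y k) @[k --> omega]).
Proof.
have /asboolP/admissibleP[M xM] := valP x.
have /asboolP/admissibleP[L yL] := valP y.
apply: (@ultra_bounded_cvg _ _ _ _ (M + L)) => // [k|]; first exact: rdist_ge0.
near=> k; apply: le_trans (rdist_triangle _ (o k) _ _) _.
rewrite lerD //; first by near: k.
by rewrite rdistC; near: k.
Unshelve. all: by end_near. Qed.

Lemma seq_distxx (x : cone_seq) : seq_dist (val x) (val x) = 0.
Proof.
rewrite /seq_dist; under eq_fun do rewrite rdistxx.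
by apply: lim_cst => //; exact: Rhausdorff.
Qed.

Lemma seq_distC (x y : nat -> X) : seq_dist x y = seq_dist y x.
Proof. by rewrite /seq_dist; under eq_fun do rewrite rdistC. Qed.

Lemma seq_dist_triangle (y x z : cone_seq) :
  seq_dist (val x) (val z) <= seq_dist (val x) (val y) + seq_dist (val y) (val z).
Proof.
rewrite /seq_dist -limD; [|exact: admissible_cvg|exact: admissible_cvg].
apply: ler_lim; [exact: admissible_cvg| |near=> k; exact: rdist_triangle].
by apply: is_cvgD; exact: admissible_cvg.
Unshelve. all: by end_near. Qed.

Lemma seq_dist_ge0 (x y : cone_seq) : 0 <= seq_dist (val x) (val y).
Proof.
rewrite -(@pmulrn_lge0 _ _ 2)// -(seq_distxx x) mulr2n {2}seq_distC.
exact: seq_dist_triangle.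
Qed.

Definition cone_equiv (x y : cone_seq) : bool := seq_dist (val x) (val y) == 0.

Lemma cone_equiv_refl : reflexive cone_equiv.
Proof. by move=> x; rewrite /cone_equiv seq_distxx. Qed.

Lemma cone_equiv_sym : symmetric cone_equiv.
Proof. by move=> x y; rewrite /cone_equiv seq_distC. Qed.

Lemma cone_equiv_trans : transitive cone_equiv.
Proof.
move=> y x z /eqP xy /eqP yz; rewrite /cone_equiv eq_le seq_dist_ge0 andbT.
by rewrite (le_trans (seq_dist_triangle y _ _)) // xy yz addr0.
Qed.

Canonical cone_equiv_rel :=
  EquivRel cone_equiv cone_equiv_refl cone_equiv_sym cone_equiv_trans.

Definition cone : Type := {eq_quot cone_equiv}%qT.
HB.instance Definition _ := Choice.on cone.
HB.instance Definition _ := EqQuotient.on cone.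

Definition cone_dist (p q : cone) : R := seq_dist (val (repr p)) (val (repr q)).

Lemma cone_repr_dist (x : cone_seq) :
  seq_dist (val x) (val (repr (\pi_cone x)%qT)) = 0.
Proof.
have /eqmodP/eqP : (\pi_cone x = \pi_cone (repr (\pi_cone x)))%qT by rewrite reprK.
by [].
Qed.

Lemma cone_distE (x y : cone_seq) :
  cone_dist (\pi_cone x)%qT (\pi_cone y)%qT = seq_dist (val x) (val y).
Proof.
have hx := cone_repr_dist x; have hy := cone_repr_dist y.
apply/eqP; rewrite eq_le /cone_dist.
set x' := repr _ in hx *; set y' := repr _ in hy *; apply/andP; split.
  rewrite (le_trans (seq_dist_triangle x _ _)) // seq_distC hx add0r.
  by rewrite (le_trans (seq_dist_triangle y _ _)) // hy addr0.
rewrite (le_trans (seq_dist_triangle x' _ _)) // hx add0r.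
by rewrite (le_trans (seq_dist_triangle y' _ _)) // [X in _ + X]seq_distC hy addr0.
Qed.

Lemma cone_dist_refl (p : cone) : cone_dist p p = 0.
Proof. exact: seq_distxx. Qed.

Lemma cone_dist_eq0 (p q : cone) : cone_dist p q = 0 -> p = q.
Proof.
move=> pq; rewrite -[p]reprK -[q]reprK; apply/eqmodP.
by rewrite /= /cone_equiv; apply/eqP.
Qed.

Lemma cone_dist_sym (p q : cone) : cone_dist p q = cone_dist q p.
Proof. exact: seq_distC. Qed.

Lemma cone_dist_triangle (q p s : cone) :
  cone_dist p s <= cone_dist p q + cone_dist q s.
Proof. exact: seq_dist_triangle. Qed.

HB.instance Definition _ := @isMetric.Build R cone cone_dist cone_dist_refl
  cone_dist_eq0 cone_dist_sym cone_dist_triangle.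

Lemma base_admissible : `[< admissible o >].
Proof. by apply/asboolP/admissibleP; exists 0; near=> k; rewrite rdistxx.
Unshelve. all: by end_near. Qed.

Definition cone_base : cone := (\pi_cone (exist _ o base_admissible : cone_seq))%qT.

Section Action.
Hypothesis div_rho : diverging rho.
Hypothesis disp_o : forall k, joint_disp (rho k) (o k) <= min_disp (rho k) + 1.
Hypothesis np_omega : nonprincipal omega.

Let bounded (g : free_group r) :=
  exists M, \forall k \near omega, rdist k (rho k g (o k)) (o k) <= M.

Lemma rdist_isom k g x y : rdist k (rho k g x) (rho k g y) = rdist k x y.
Proof. by rewrite /rdist rep_isom. Qed.

Let boundedM g h : bounded g -> bounded h -> bounded (g * h)%g.
Proof.
move=> [M gM] [L hL]; exists (L + M); near=> k; rewrite repM.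
apply: le_trans (rdist_triangle _ (rho k g (o k)) _ _) _.
by rewrite rdist_isom lerD //; near: k.
Unshelve. all: by end_near. Qed.

Let boundedV g : bounded g -> bounded (g^-1)%g.
Proof.
move=> [M gM]; exists M; near=> k.
rewrite rdistC -(rdist_isom k g) -repM mulgV rep1; near: k.
exact: gM.
Unshelve. all: by end_near. Qed.

Let bounded_gen i : bounded (gen i).
Proof.
exists 2; have := nonprincipal_oo UF np_omega; apply.
have /cvgryPge/(_ 1) := div_rho; apply: filterS => k r1.
rewrite /rdist mulrC ler_pdivrMr ?(lt_le_trans ltr01) // metric_sym.
have dk : mdist (o k) (rho k (gen i) (o k)) <= joint_disp (rho k) (o k).
  exact: le_bigmax.
by have := disp_o k; lra.
Qed.

Let bounded_rep g : bounded g.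
Proof.
case: g => w rw; elim: w rw => [|a w IHw] rw.
  exists 0; near=> k; rewrite (_ : FreeGroup rw = 1%g) ?rep1 ?rdistxx //.
  exact/val_inj.
have rw' : reduced w by apply: path_sorted rw.
have ra : reduced [:: a] by [].
have -> : FreeGroup rw = (FreeGroup ra * FreeGroup rw')%g.
  by apply/val_inj; rewrite /= reduced_push_id.
apply: boundedM (IHw rw'); case: a {rw} ra => i [] ra.
  rewrite (_ : FreeGroup ra = gen i) //; exact/val_inj.
rewrite (_ : FreeGroup ra = (gen i)^-1%g); last exact/val_inj.
exact: boundedV.
Unshelve. all: by end_near. Qed.

Lemma rep_admissible g (x : cone_seq) :
  `[< admissible (fun k => rho k g (val x k)) >].
Proof.
have [M gM] := bounded_rep g; have /asboolP/admissibleP[L xL] := valP x.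
apply/asboolP/admissibleP; exists (L + M); near=> k.
apply: le_trans (rdist_triangle _ (rho k g (o k)) _ _) _.
by rewrite rdist_isom lerD //; near: k.
Unshelve. all: by end_near. Qed.

Definition seq_act (g : free_group r) (x : cone_seq) : cone_seq :=
  exist _ (fun k => rho k g (val x k)) (rep_admissible g x).

Definition cone_act (g : free_group r) (p : cone) : cone :=
  (\pi_cone (seq_act g (repr p)))%qT.

Lemma seq_act_dist g x y :
  seq_dist (val (seq_act g x)) (val (seq_act g y)) = seq_dist (val x) (val y).
Proof. by rewrite /seq_dist /=; under eq_fun do rewrite rdist_isom. Qed.

Lemma cone_actE g (x : cone_seq) :
  cone_act g (\pi_cone x)%qT = (\pi_cone (seq_act g x))%qT.
Proof.
apply: cone_dist_eq0; rewrite cone_distE seq_act_dist seq_distC.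
exact: cone_repr_dist.
Qed.

Lemma cone_act1 p : cone_act 1%g p = p.
Proof.
rewrite -[p]reprK cone_actE; congr (\pi_cone _)%qT.
by apply/val_inj/funext => k /=; rewrite rep1.
Qed.

Lemma cone_actM g h p : cone_act (g * h)%g p = cone_act g (cone_act h p).
Proof.
elim/quotW: p => x; rewrite (cone_actE h) !cone_actE; congr (\pi_cone _)%qT.
by apply/val_inj/funext => k /=; rewrite repM.
Qed.

Lemma cone_act_isom g p q : mdist (cone_act g p) (cone_act g q) = mdist p q.
Proof.
elim/quotW: p => x; elim/quotW: q => y.
by rewrite !cone_actE /mdist /= !cone_distE seq_act_dist.
Qed.

Definition cone_rep : isom_rep r cone := IsomRep cone_act1 cone_actM cone_act_isom.

End Action.
End Cone.

(* The metric on a subset is the restriction of the ambient one. *)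
Section SubspaceMetric.
Variables (R : realType) (X : metricType R) (A : set X).
Implicit Types x y : A.

Let sub_dist x y : R := mdist (\val x) (\val y).

Let sub_dist_ge0 x y : 0 <= sub_dist x y.
Proof. exact: mdist_ge0. Qed.

Let sub_dist_eq0 x y : sub_dist x y = 0 -> x = y.
Proof. by move/mdist_positivity/val_inj. Qed.

Let sub_ballE x (d : R) : ball x d = [set y | sub_dist x y < d].
Proof.
by rewrite -[ball x d]/(\val @^-1` ball (\val x) d) ballEmdist.
Qed.

HB.instance Definition _ :=
  @PseudoMetric_isMetric.Build R A sub_dist sub_dist_ge0 sub_dist_eq0 sub_ballE.

End SubspaceMetric.

Section Subtree.
Variables (R : realType) (r : nat) (X : metricType R) (rho : isom_rep r X).

Definition geodesically_convex (T : set X) : Prop :=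
  forall (L : R) (c : R -> X),
    (forall s t, 0 <= s <= L -> 0 <= t <= L -> mdist (c s) (c t) = `|s - t|) ->
    0 <= L -> T (c 0) -> T (c L) -> forall t, 0 <= t <= L -> T (c t).

Definition invariant_set (T : set X) : Prop := forall g x, T x -> T (rho g x).

Definition invariant_subtree (T : set X) : Prop :=
  [/\ T !=set0, closed T, geodesically_convex T & invariant_set T].

Definition minimal_subtree (T : set X) : Prop :=
  invariant_subtree T /\
  forall T', invariant_subtree T' -> T' `<=` T -> T' = T.

Lemma minimal_subtree_invariant (T : set X) : minimal_subtree T -> invariant_set T.
Proof. by case=> -[]. Qed.

Section Restriction.
Variables (T : set X) (invT : invariant_set T).

Definition restr_act (g : free_group r) (x : T) : T :=
  exist _ (rho g (\val x)) (mem_set (invT g (set_mem (valP x)))).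

Lemma restr_act1 x : restr_act 1%g x = x.
Proof. by apply/val_inj; rewrite /= rep1. Qed.

Lemma restr_actM g h x : restr_act (g * h)%g x = restr_act g (restr_act h x).
Proof. by apply/val_inj; rewrite /= repM. Qed.

Lemma restr_act_isom g x y :
  mdist (restr_act g x) (restr_act g y) = mdist x y.
Proof. exact: rep_isom. Qed.

Definition restr_rep : isom_rep r T :=
  IsomRep restr_act1 restr_actM restr_act_isom.

End Restriction.

Definition tree_rep (T : set X) (minT : minimal_subtree T) : isom_rep r T :=
  restr_rep (minimal_subtree_invariant minT).

End Subtree.

Definition schottky (R : realType) (r : nat) (X : metricType R)
    (rho : isom_rep r X) (o : X) : Prop :=
  exists2 K : R, 1 <= K & forall g h : free_group r,
    K^-1 * (word_length (g^-1 * h)%g)%:R - K <= mdist (rho g o) (rho h o) /\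
    mdist (rho g o) (rho h o) <= K * (word_length (g^-1 * h)%g)%:R + K.

(* Visual boundary: geodesic rays [0, +oo[ -> X up to bounded distance. A ray is
   represented by a function on R, whose values on negative numbers play no
   role in the equivalence. *)
Section Boundary.
Variables (R : realType) (X : metricType R).

Definition is_ray (c : R -> X) : Prop :=
  forall s t, 0 <= s -> 0 <= t -> mdist (c s) (c t) = `|s - t|.

Definition ray : Type := {c : R -> X | `[< is_ray c >]}.
HB.instance Definition _ := Choice.on ray.

Definition asymptotic (c c' : ray) : bool :=
  `[< exists M : R, forall t, 0 <= t -> mdist (val c t) (val c' t) <= M >].

Lemma asymptotic_refl : reflexive asymptotic.
Proof. by move=> c; apply/asboolP; exists 0 => t _; rewrite mdistxx. Qed.

Lemma asymptotic_sym : symmetric asymptotic.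
Proof.
move=> c c'; apply/asboolP/asboolP => -[M cM]; exists M => t t0;
by rewrite metric_sym cM.
Qed.

Lemma asymptotic_trans : transitive asymptotic.
Proof.
move=> c' c c'' /asboolP[M cM] /asboolP[L cL]; apply/asboolP; exists (M + L) => t t0.
by apply: le_trans (metric_triangle _ (val c' t) _) _; rewrite lerD ?cM ?cL.
Qed.

Canonical asymptotic_rel :=
  EquivRel asymptotic asymptotic_refl asymptotic_sym asymptotic_trans.

Definition boundary : Type := {eq_quot asymptotic}%qT.
HB.instance Definition _ := Choice.on boundary.
HB.instance Definition _ := EqQuotient.on boundary.

Definition gromov (o x y : X) : R := (mdist x o + mdist y o - mdist x y) / 2.

(* Extensions of the Gromov product to boundary points, with values in \bar R.
   In a complete CAT(-1) space the Gromov product extends continuously, so that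
   the limits exist and do not depend on the rays. *)
Definition gromov_pt (o x : X) (xi : boundary) : \bar R :=
  get [set l | forall c : ray, (\pi_boundary c)%qT = xi ->
    (gromov o x (val c t))%:E @[t --> +oo] --> l].

Definition gromov_bd (o : X) (xi zeta : boundary) : \bar R :=
  get [set l | forall c c' : ray,
    (\pi_boundary c)%qT = xi -> (\pi_boundary c')%qT = zeta ->
    (gromov o (val c t) (val c' t))%:E @[t --> +oo] --> l].

Definition visual_dist (o : X) (xi zeta : boundary) : \bar R :=
  expeR (- gromov_bd o xi zeta)%E.

(* A sequence x_n of points of X converges to xi in the union of X and its
   boundary if and only if the Gromov products of x_n and xi tend to +oo. *)
Definition limit_set (r : nat) (rho : isom_rep r X) (o : X) : set boundary :=
  [set xi | exists g : nat -> free_group r,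
    gromov_pt o (rho (g n) o) xi @[n --> \oo] --> +oo%E].

End Boundary.

Section Hausdorff.
Local Open Scope ereal_scope.
Variables (R : realType) (E : Type) (delta : E -> E -> \bar R).

Definition diameter (U : set E) : \bar R :=
  ereal_sup (0 |` [set delta x y | x in U & y in U]).

Definition hausdorff_premeasure (s eps : R) (A : set E) : \bar R :=
  ereal_inf [set \sum_(n <oo) diameter (U n) `^ s | U in
    [set U : nat -> set E |
      A `<=` \bigcup_n U n /\ forall n, diameter (U n) <= eps%:E]].

Definition hausdorff_measure (s : R) (A : set E) : \bar R :=
  ereal_sup [set hausdorff_premeasure s eps A | eps in [set eps | (0 < eps)%R]].

(* Restricting to s > 0 does not change the infimum and avoids 0 `^ 0. *)
Definition Hdim (A : set E) : \bar R :=
  ereal_inf [set s%:E | s in [set s | (0 < s)%R /\ hausdorff_measure s A = 0]].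

End Hausdorff.

(* Main.v *)
Require Import Defs.
From mathcomp Require Import all_boot all_order all_algebra.
From mathcomp Require Import all_classical all_reals all_analysis.
From mathcomp Require Import zify ring lra.

Set Implicit Arguments.
Unset Strict Implicit.
Unset Printing Implicit Defensive.

Import Order.TTheory GRing.Theory Num.Theory.
Import numFieldNormedType.Exports.

Local Open Scope classical_set_scope.
Local Open Scope ring_scope.

(** The theorem compares the two visual metrics directly, through the Gromov
    products of orbit points.

    Write [(g|h)_T] for the Gromov product of the orbit points of [g] and [h] in
    the tree, [(g|h)_k] for the one in hyperbolic space, and [r_k] for the minimal
    displacement. For every [e > 0] there is a constant [C] such that, along the
    ultrafilter,
      [(1 - e) (g|h)_T - C <= (g|h)_k / r_k <= (1 + e) (g|h)_T + C]
    for all [g] and [h] at once ([gromov_close]). Since the visual distance is the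
    exponential of minus the Gromov product, this says that sending a limit point
    of an orbit sequence in one space to the limit point of the same sequence in
    the other is a Hoelder correspondence between the limit sets, of exponent
    [r_k (1 - e)] in one direction and [1 / (r_k (1 + e))] in the other. Hoelder
    correspondences rescale Hausdorff dimension ([Hdim_holder]), so that
    [(1 - e) r_k Hdim_k <= Hdim_T <= (1 + e) r_k Hdim_k], and letting [e] tend to
    zero along a subsequence gives the limit.

    The uniformity in [g] and [h] is a local-to-global principle. By definition
    of the asymptotic cone, the length functions [d(o, g o) / r_k] converge to the
    length function of the tree, but only uniformly on finite sets of words. In
    the tree, the Schottky hypothesis bounds all Gromov products
    [(u^-1|v)] with [u v] reduced ([tree_backtrack]), while words of a fixed large
    length [L] move the base point far. Both facts, being about words of length at
    most [2 L], pass to [d / r_k]; as this metric is hyperbolic with a constant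
    tending to zero, paths made of long steps with small Gromov products are
    quasi-geodesics along which lengths add up to a small error per step
    ([local_to_global], [length_close]). Splitting [g] and [h] at their longest
    common prefix then controls [(g|h)].

    The boundaries enter through three properties, established for hyperbolic
    space from the hyperboloid model and for the tree from the ultrametric
    inequality of the Gromov product: the quasi-ultrametric inequality
    ([hyperbolic]), strong asymptoticity of asymptotic rays ([ray_rigid]), which
    makes Gromov products of boundary points well defined, and convergence of
    Gromov sequences to rays ([gromov_complete]). The tree inherits the first from
    hyperbolic space by rescaling, and its geodesics are limits of geodesics. *)

(** * Words and length functions on a free group *)

Section Words.
Variable r : nat.
Implicit Types u v w : seq (letter r).

Definition fg_of w : free_group r :=
  FreeGroup (reduced_foldr w (v := [::]) isT).

Lemma fg_of_nil : fg_of [::] = 1%g.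
Proof. exact/val_inj. Qed.

Lemma fg_of_cat u v : fg_of (u ++ v) = (fg_of u * fg_of v)%g.
Proof.
apply/val_inj; rewrite /= foldr_cat.
rewrite [RHS](_ : _ = foldr (@push _) (fg_of v) (fg_of u)) //.
by rewrite foldr_pushA ?fg_reduced.
Qed.

Lemma fg_of_word (g : free_group r) : fg_of g = g.
Proof. by apply/val_inj; rewrite /= foldr_push_nil ?fg_reduced. Qed.

Lemma fg_of_inv u : fg_of (word_inv u) = (fg_of u)^-1%g.
Proof.
have h : (fg_of (word_inv u) * fg_of u = 1)%g.
  rewrite -fg_of_cat; apply/val_inj.
  by rewrite /= foldr_cat -foldr_pushA // foldr_inv.
by rewrite -[LHS]mulg1 -(mulgV (fg_of u)) mulgA h mul1g.
Qed.

Lemma size_fg_of w : reduced w -> word_length (fg_of w) = size w.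
Proof. by move=> rw; rewrite /word_length /= foldr_push_nil. Qed.

Lemma word_inv_cat u v : word_inv (u ++ v) = word_inv v ++ word_inv u.
Proof. by rewrite /word_inv map_cat rev_cat. Qed.

Lemma reduced_catl u v : reduced (u ++ v) -> reduced u.
Proof. by move=> /cat_sorted2[]. Qed.

Lemma reduced_catr u v : reduced (u ++ v) -> reduced v.
Proof. by move=> /cat_sorted2[]. Qed.

(** The longest common prefix is taken for [p], so that there is no cancellation
    between the inverse of one remainder and the other remainder. *)
Lemma common_prefix u v : reduced u -> reduced v ->
  exists p u' v', [/\ u = p ++ u', v = p ++ v' & reduced (word_inv u' ++ v')].
Proof.
elim: u v => [|a u IHu] v ru rv.
  by exists [::], [::], v; split.
case: v rv => [|b v] rv.
  exists [::], (a :: u), [::]; split=> //; rewrite cats0.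
  exact: reduced_inv.
have [eab|nab] := eqVneq a b.
  rewrite -eab in rv *.
  have [p [u' [v' [-> -> h]]]] := IHu v (path_sorted ru) (path_sorted rv).
  by exists (a :: p), u', v'.
exists [::], (a :: u), (b :: v); split=> //.
have rui := reduced_inv ru.
rewrite /word_inv /= rev_cons -cats1 -catA /=.
move: rui; rewrite /reduced /word_inv /= rev_cons.
case: (rev _) => [|c s] /=.
  by rewrite letter_invK eq_sym nab.
by rewrite rcons_path cat_path /= letter_invK [b == a]eq_sym nab => /andP[-> ->].
Qed.

End Words.

Section LengthFunctions.
Variables (R : realType) (r : nat).
Implicit Types (D : free_group r -> R) (f g h : free_group r).
Implicit Types u v w : seq (letter r).

Definition len_gromov D g h : R := (D g + D h - D (g^-1 * h)%g) / 2.

(** Lyndon length functions, with an error [delta] in the ultrametric inequality: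
    the distances [d(o, g o)] of an action by isometries on a hyperbolic space.
    Working with them makes the tree and hyperbolic space two instances of the
    same object, whatever the scale of the metric. *)
Record hyp_length D (delta : R) : Prop := HypLength {
  len1 : D 1%g = 0;
  lenV : forall g, D (g^-1)%g = D g;
  lenM : forall g h, D (g * h)%g <= D g + D h;
  len_hyp : forall m f g h, m <= len_gromov D f g -> m <= len_gromov D g h ->
    m - delta <= len_gromov D f h }.

(** The Gromov product, seen from the break point, of the two ends of the path
    of [u ++ v]; by equivariance it depends on the two words only. *)
Definition backtrack D u v : R := len_gromov D (fg_of u)^-1%g (fg_of v).

Section Basic.
Variables (D : free_group r -> R) (delta : R) (lD : hyp_length D delta).

Lemma len_gromovC g h : len_gromov D g h = len_gromov D h g.
Proof. by rewrite /len_gromov -(lenV lD (g^-1 * h)%g) invgM invgK [D g + D h]addrC. Qed.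

Lemma len_gromov_ge0 g h : 0 <= len_gromov D g h.
Proof. by rewrite /len_gromov; have := lenM lD g^-1%g h; rewrite (lenV lD); lra. Qed.

Lemma len_gromov_le g h : len_gromov D g h <= D g.
Proof.
have := lenM lD g (g^-1 * h)%g; rewrite mulgA mulgV mul1g /len_gromov; lra.
Qed.

Lemma backtrackE u v :
  backtrack D u v = (D (fg_of u) + D (fg_of v) - D (fg_of (u ++ v))) / 2.
Proof. by rewrite /backtrack /len_gromov invgK (lenV lD) fg_of_cat. Qed.

Lemma backtrack_inv u v :
  backtrack D (word_inv u) v = len_gromov D (fg_of u) (fg_of v).
Proof. by rewrite /backtrack fg_of_inv invgK. Qed.

Lemma len_gromov_suffix u v :
  len_gromov D (fg_of (u ++ v))^-1%g (fg_of v)^-1%g =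
  D (fg_of v) - backtrack D u v.
Proof.
rewrite backtrackE /len_gromov invgK !(lenV lD) !fg_of_cat -mulgA mulgV mulg1.
by field.
Qed.

Lemma len_gromov_prefix u v :
  len_gromov D (fg_of u) (fg_of (u ++ v)) = D (fg_of u) - backtrack D u v.
Proof.
rewrite backtrackE /len_gromov !fg_of_cat mulgA mulVg mul1g.
by field.
Qed.

(** The ends of two words that separate after [p] are seen from the origin in
    the direction of [p], up to three Gromov products based at [p]. *)
Lemma len_gromov_branch p u v :
  len_gromov D (fg_of (p ++ u)) (fg_of (p ++ v)) =
  D (fg_of p) - backtrack D p u - backtrack D p v + backtrack D (word_inv u) v.
Proof.
rewrite backtrack_inv !backtrackE /len_gromov !fg_of_cat invgM -mulgA.
by rewrite (mulgA (fg_of p)^-1%g) mulVg mul1g; field.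
Qed.

End Basic.

Section LocalToGlobal.
Variables (D : free_group r -> R) (delta A : R) (L : nat).
Hypotheses (lD : hyp_length D delta) (delta_ge0 : 0 <= delta).
Hypothesis short_backtrack : forall u v, reduced (u ++ v) ->
  (size u <= L)%N -> (size v <= L)%N -> backtrack D u v <= A.
Hypothesis long_step : forall u, reduced u -> size u = L ->
  2 * A + 4 * delta < D (fg_of u).

(** Gromov products of consecutive steps that are small compared with the
    length of the steps stay small on the whole word: the ends of the word are
    seen, from a break point, in the direction of the adjacent steps. *)
Lemma local_to_global u v : reduced (u ++ v) -> backtrack D u v <= A + 2 * delta.
Proof.
have d0 := delta_ge0.
have [n] := ubnP (size u + size v); elim: n u v => // n IHn u v.
rewrite ltnS => sz ruv.
have ru := reduced_catl ruv; have rv := reduced_catr ruv.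
have A0 : 0 <= A.
  have := @short_backtrack [::] [::] isT isT isT.
  by rewrite (backtrackE lD) fg_of_nil (len1 lD); lra.
have [u0|u_gt0] := posnP (size u).
  by rewrite (size0nil u0) (backtrackE lD) fg_of_nil (len1 lD) cat0s add0r subrr mul0r; lra.
have [v0|v_gt0] := posnP (size v).
  by rewrite (size0nil v0) (backtrackE lD) fg_of_nil (len1 lD) cats0 addr0 subrr mul0r; lra.
pose u1 := take (size u - L) u; pose u2 := drop (size u - L) u.
pose v2 := take L v; pose v1 := drop L v.
have eu : u = u1 ++ u2 by rewrite cat_take_drop.
have ev : v = v2 ++ v1 by rewrite cat_take_drop.
have su2 : (size u2 <= L)%N by rewrite size_drop; clear; lia.
have sv2 : (size v2 <= L)%N by rewrite size_take_min; clear; lia.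
have ruv2 : reduced (u2 ++ v2).
  by move: ruv; rewrite eu ev -catA => /reduced_catr; rewrite catA => /reduced_catl.
have b2 := short_backtrack ruv2 su2 sv2.
(* Otherwise every term of the chain u2^-1, u^-1, v, v2 of ends would see the
   next one with a product above A + 2 delta. *)
rewrite leNgt; apply/negP => big.
have bu : A + 2 * delta < len_gromov D (fg_of u2)^-1%g (fg_of u)^-1%g.
  have [lu|Lu] := leqP (size u) L.
    have -> : u2 = u by rewrite /u2 (eqP (_ : size u - L == 0)%N) ?drop0 // subn_eq0.
    have -> : len_gromov D (fg_of u)^-1%g (fg_of u)^-1%g = D (fg_of u)^-1%g.
      by rewrite /len_gromov invgK mulgV (len1 lD); field.
    by apply: lt_le_trans big (len_gromov_le lD _ _).
  have su2' : size u2 = L by rewrite size_drop; move: Lu; clear; lia.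
  have ru2 : reduced u2 by move: ru; rewrite eu => /reduced_catr.
  have : backtrack D u1 u2 <= A + 2 * delta.
    apply: IHn; last by rewrite -eu.
    by rewrite su2' size_take_min; move: Lu sz v_gt0; clear; lia.
  rewrite (len_gromovC lD) eu (len_gromov_suffix lD).
  by have := long_step ru2 su2'; lra.
have bv : A + 2 * delta < len_gromov D (fg_of v) (fg_of v2).
  have [lv|Lv] := leqP (size v) L.
    have -> : v2 = v by rewrite /v2 take_oversize.
    have -> : len_gromov D (fg_of v) (fg_of v) = D (fg_of v).
      by rewrite /len_gromov mulVg (len1 lD); field.
    by apply: lt_le_trans big _; rewrite /backtrack (len_gromovC lD) (len_gromov_le lD).
  have sv2' : size v2 = L by rewrite size_take_min; move: Lv; clear; lia.
  have rv2 : reduced v2 by move: rv; rewrite ev => /reduced_catl.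
  have : backtrack D v2 v1 <= A + 2 * delta.
    apply: IHn; last by rewrite -ev.
    by rewrite sv2' size_drop; move: Lv sz u_gt0; clear; lia.
  rewrite (len_gromovC lD) ev (len_gromov_prefix lD).
  by have := long_step rv2 sv2'; lra.
pose m := Num.min (backtrack D u v)
  (Num.min (len_gromov D (fg_of u2)^-1%g (fg_of u)^-1%g)
           (len_gromov D (fg_of v) (fg_of v2))).
have mA : A + 2 * delta < m by rewrite !lt_min big bu bv.
have m1 : m <= len_gromov D (fg_of u2)^-1%g (fg_of u)^-1%g by rewrite !ge_min lexx orbT.
have m2 : m <= len_gromov D (fg_of u)^-1%g (fg_of v) by rewrite ge_min lexx.
have m3 : m <= len_gromov D (fg_of v) (fg_of v2) by rewrite !ge_min lexx !orbT.
have m12 := len_hyp lD m1 m2.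
have m3' : m - delta <= len_gromov D (fg_of v) (fg_of v2) by lra.
by have := len_hyp lD m12 m3'; move: b2; rewrite /backtrack; lra.
Qed.

(** For the same reason only the last [L] letters of a long word matter for
    its Gromov product with a continuation. *)
Lemma backtrack_suffix w z u : reduced (w ++ z ++ u) -> size z = L ->
  `|backtrack D (w ++ z) u - backtrack D z u| <= delta.
Proof.
move=> red sz; have d0 := delta_ge0.
have rwz : reduced (w ++ z) by move: red; rewrite catA => /reduced_catl.
have h1 := local_to_global rwz.
have rz := reduced_catr rwz.
have h2 : backtrack D (w ++ z) u <= A + 2 * delta.
  by apply: local_to_global; rewrite -catA.
have h3 : backtrack D z u <= A + 2 * delta.
  by apply: local_to_global; exact: reduced_catr red.
have g := len_gromov_suffix lD w z.
have ls := long_step rz sz.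
rewrite ler_distl; apply/andP; split.
  apply: (len_hyp lD (g := (fg_of z)^-1%g)); last by [].
  by rewrite g; lra.
suff : backtrack D (w ++ z) u - delta <= backtrack D z u by lra.
apply: (len_hyp lD (g := (fg_of (w ++ z))^-1%g)); last by [].
by rewrite (len_gromovC lD) g; lra.
Qed.

End LocalToGlobal.

Section Tree.
Variables (D : free_group r -> R) (lD : hyp_length D 0) (K : R).
Hypotheses (K_ge1 : 1 <= K)
  (len_lb : forall g, K^-1 * (word_length g)%:R - K <= D g)
  (len_ub : forall g, D g <= K * (word_length g)%:R + K).

Lemma len_letter (a : letter r) : D (fg_of [:: a]) <= 2 * K.
Proof. have K1 := K_ge1; apply: le_trans (len_ub _) _; rewrite size_fg_of //= mulr1; lra.
Qed.

(** The path through the inverses of the suffixes of [u] leaves the region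
    [m <= (. | h)] by a step of length at most [2 * K], and therefore close to
    its boundary point, which is at distance [m] from the origin. *)
Lemma suffix_near_branch u h m : 0 <= m -> m <= len_gromov D (fg_of u)^-1%g h ->
  exists u1 u2, [/\ u = u1 ++ u2, m <= len_gromov D (fg_of u2)^-1%g h &
    D (fg_of u2) <= m + 2 * K].
Proof.
have K1 := K_ge1; move=> m0; elim: u => [|a u IHu] mu.
  exists [::], [::]; split=> //.
  by rewrite fg_of_nil (len1 lD); lra.
have [small|big] := lerP (D (fg_of (a :: u))) (m + 2 * K).
  by exists [::], (a :: u); split.
have [|u1 [u2 [-> h1 h2]]] := IHu; last by exists (a :: u1), u2.
rewrite -[m]subr0; apply: (len_hyp lD) mu.
rewrite (len_gromovC lD) -cat1s (len_gromov_suffix lD) (backtrackE lD).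
have := len_letter a; have := lenM lD (fg_of [:: a]) (fg_of u).
by move: big; rewrite -cat1s fg_of_cat; lra.
Qed.

(** The two points near the branch point found by [suffix_near_branch] on the two
    sides of the break point are at distance at most [4 * K] from each other.
    As the length of a word is controlled by the distance it covers, the word
    between them is short, and so is the part of it that leads from the break
    point to the branch point. *)
Lemma tree_backtrack u v : reduced (u ++ v) -> backtrack D u v <= 5 * K ^+ 3 + K.
Proof.
move=> ruv; set m := backtrack D u v.
have m0 : 0 <= m by apply: (len_gromov_ge0 lD).
have [u1 [u2 [eu mu Du]]] := suffix_near_branch m0 (lexx m).
(* the suffix of u found, the same is done on the other side, for the inverse of v *)
have [|v1' [v2' [ev mv Dv]]] :=
  @suffix_near_branch (word_inv v) (fg_of u2)^-1%g m m0.
  by rewrite fg_of_inv invgK (len_gromovC lD).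
pose v1 := word_inv v1'; pose v2 := word_inv v2'.
have {}ev : v = v2 ++ v1 by rewrite -word_inv_cat -ev word_invK.
have e2 : fg_of v2 = (fg_of v2')^-1%g by rewrite fg_of_inv.
rewrite -e2 (len_gromovC lD) in mv; rewrite -[D _](lenV lD) -e2 in Dv.
have red : reduced (u2 ++ v2).
  by move: ruv; rewrite eu ev -catA => /reduced_catr; rewrite catA => /reduced_catl.
have K1 := K_ge1; have K0 : 0 < K by lra.
have D4 : D (fg_of (u2 ++ v2)) <= 4 * K.
  have : m <= backtrack D u2 v2 by [].
  by rewrite (backtrackE lD); lra.
have := len_lb (fg_of (u2 ++ v2)); rewrite size_fg_of // size_cat.
move=> /le_trans /(_ D4); rewrite lerBlDr ler_pdivrMl // => sz.
have su : (size u2)%:R <= 5 * K ^+ 2 :> R.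
  apply: le_trans (le_trans sz _); first by rewrite ler_nat leq_addr.
  by rewrite le_eqVlt; apply/orP; left; apply/eqP; ring.
have := len_ub (fg_of u2); rewrite size_fg_of ?(reduced_catl red) // => Du2.
apply: le_trans (le_trans mu _) (le_trans Du2 _).
  by rewrite -[D (fg_of u2)](lenV lD); apply: (len_gromov_le lD).
rewrite lerD2r (_ : 5 * K ^+ 3 = K * (5 * K ^+ 2)); last ring.
by rewrite ler_pM2l.
Qed.

(** A bound for the Gromov products of [tree_backtrack], with room for an error. *)
Definition bt_bound : R := 5 * K ^+ 3 + K + 2.

(** Words of length [L] cover much more than the Gromov products, which is the
    hypothesis [long_step] of the local-to-global principle. *)
Lemma tree_scale : exists2 L : nat, (0 < L)%N &
  2 * bt_bound + 5 < K^-1 * L%:R - K.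
Proof.
have K1 := K_ge1; have K0 : 0 < K by lra.
pose x := K * (2 * bt_bound + 5 + K).
exists (Num.truncn `|x|).+1 => //.
rewrite ltrBrDr ltr_pdivlMl //.
apply: le_lt_trans (ler_norm _) _.
exact: truncnS_gt.
Qed.

Section Comparison.
Variables (L : nat) (L_gt0 : (0 < L)%N).
Hypothesis L_big : 2 * bt_bound + 5 < K^-1 * L%:R - K.
Variables (D' : free_group r -> R) (delta eta : R).
Hypotheses (lD' : hyp_length D' delta) (delta_ge0 : 0 <= delta)
  (delta_le : delta <= eta) (eta_le1 : eta <= 1).
Hypothesis close : forall w, reduced w -> (size w <= 2 * L)%N ->
  `|D' (fg_of w) - D (fg_of w)| <= eta.

Lemma bt_bound_ge0 : 0 <= bt_bound.
Proof. by have K1 := K_ge1; rewrite /bt_bound !addr_ge0 // ?mulr_ge0 ?exprn_ge0 //; lra. Qed.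

Let backtrack_close u v : reduced (u ++ v) -> (size u <= L)%N -> (size v <= L)%N ->
  `|backtrack D' u v - backtrack D u v| <= 3 / 2 * eta.
Proof.
move=> red su sv.
have /ler_normlP[c1 c2] : `|D' (fg_of u) - D (fg_of u)| <= eta.
  by apply: close; [exact: reduced_catl red|move: su; clear; lia].
have /ler_normlP[c3 c4] : `|D' (fg_of v) - D (fg_of v)| <= eta.
  by apply: close; [exact: reduced_catr red|move: sv; clear; lia].
have /ler_normlP[c5 c6] : `|D' (fg_of (u ++ v)) - D (fg_of (u ++ v))| <= eta.
  by apply: close; [exact: red|rewrite size_cat; move: su sv; clear; lia].
by rewrite (backtrackE lD) (backtrackE lD'); apply/ler_normlP; split; lra.
Qed.

Let short' u v : reduced (u ++ v) -> (size u <= L)%N -> (size v <= L)%N ->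
  backtrack D' u v <= bt_bound.
Proof.
move=> red su sv; have e1 := eta_le1.
have /ler_normlP[_ +] := backtrack_close red su sv.
by have := tree_backtrack red; have K1 := K_ge1; rewrite /bt_bound; lra.
Qed.

Let short u v : reduced (u ++ v) -> (size u <= L)%N -> (size v <= L)%N ->
  backtrack D u v <= bt_bound.
Proof. by move=> red _ _; have := tree_backtrack red; have K1 := K_ge1; rewrite /bt_bound; lra. Qed.

Let long u : reduced u -> size u = L -> 2 * bt_bound + 4 * 0 < D (fg_of u).
Proof.
have Lb := L_big.
by move=> ru su; have := len_lb (fg_of u); rewrite size_fg_of // su; lra.
Qed.

Let long' u : reduced u -> size u = L -> 2 * bt_bound + 4 * delta < D' (fg_of u).
Proof.
move=> ru su; have := len_lb (fg_of u); rewrite size_fg_of // su.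
have de := delta_le; have e1 := eta_le1; have Lb := L_big.
have /ler_normlP[+ _] : `|D' (fg_of u) - D (fg_of u)| <= eta.
  by apply: close => //; rewrite su; clear; lia.
lra.
Qed.

Lemma backtrack_le' u v : reduced (u ++ v) -> backtrack D' u v <= bt_bound + 2.
Proof.
have de := delta_le; have e1 := eta_le1.
move=> red; have := local_to_global lD' delta_ge0 short' long' red.
lra.
Qed.

(** Appending a step [u] of length [L] changes both lengths by the length of [u]
    minus twice a Gromov product, and by [backtrack_suffix] the latter can be
    read off on a word of length [2 * L], where the two functions are close. *)
Lemma length_close w : reduced w ->
  `|D' (fg_of w) - D (fg_of w)| <= eta * (1 + 6 * (size w)%:R).
Proof.
have [n] := ubnP (size w); elim: n w => // n IHn w.
rewrite ltnS => szw rw; have d0 := delta_ge0; have de := delta_le; have e1 := eta_le1.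
have eta0 : 0 <= eta by lra.
have [small|big] := leqP (size w) (2 * L).
  have h := close rw small; apply: (le_trans h); rewrite ler_peMr // lerDl.
  by rewrite mulr_ge0.
pose w' := take (size w - L) w; pose u := drop (size w - L) w.
have ew : w = w' ++ u by rewrite cat_take_drop.
have su : size u = L by rewrite size_drop; move: big; clear; lia.
have sw' : size w' = (size w - L)%N by rewrite size_take_min; clear; lia.
pose y := take (size w' - L) w'; pose z := drop (size w' - L) w'.
have ew' : w' = y ++ z by rewrite cat_take_drop.
have sz : size z = L by rewrite size_drop; move: big sw'; clear; lia.
have red : reduced (y ++ z ++ u) by rewrite catA -ew' -ew.
have rzu := reduced_catr red.
have b := backtrack_suffix lD (lexx 0) short long red sz.
have b' := backtrack_suffix lD' delta_ge0 short' long' red sz.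
rewrite -ew' in b b'.
have rw' : reduced w' by move: rw; rewrite ew => /reduced_catl.
have ih : `|D' (fg_of w') - D (fg_of w')| <= eta * (1 + 6 * (size w')%:R).
  by apply: IHn => //; move: szw big sw' L_gt0; clear; lia.
have cu : `|D' (fg_of u) - D (fg_of u)| <= eta.
  by apply: close; [exact: reduced_catr rzu|rewrite su; clear; lia].
have cz : `|backtrack D' z u - backtrack D z u| <= 3 / 2 * eta.
  by apply: backtrack_close => //; rewrite ?sz ?su.
have : eta * (1 + 6 * (size w')%:R) + 6 * eta <= eta * (1 + 6 * (size w)%:R).
  rewrite (_ : _ + 6 * eta = eta * (1 + 6 * (size w').+1%:R)).
    by rewrite ler_wpM2l // lerD2l ler_wpM2l // ler_nat; move: big sw' L_gt0; clear; lia.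
  by rewrite -natr1; ring.
move: b b' ih cu cz => /ler_normlP[b1 b2] /ler_normlP[b3 b4] /ler_normlP[i1 i2].
move=> /ler_normlP[c1 c2] /ler_normlP[d1 d2].
have := backtrackE lD w' u; have := backtrackE lD' w' u; rewrite -ew => f1 f2 hh.
by apply/ler_normlP; split; lra.
Qed.

(** By [len_gromov_branch] both Gromov products are, up to constants, the lengths
    of the common prefix. The error of [length_close] is proportional to the
    number of letters of the prefix, hence to its length in the tree. *)
Lemma gromov_close g h :
  `|len_gromov D' g h - len_gromov D g h| <=
  6 * K * eta * len_gromov D g h
   + (12 * K * (bt_bound + 2) + 6 * K ^+ 2 + 1 + 4 * (bt_bound + 2)).
Proof.
have d0 := delta_ge0; have de := delta_le; have e1 := eta_le1.
have eta0 : 0 <= eta by lra.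
have [p [u [v [eg eh red]]]] := common_prefix (fg_reduced g) (fg_reduced h).
rewrite -[g]fg_of_word -[h]fg_of_word eg eh.
rewrite (len_gromov_branch lD) (len_gromov_branch lD').
have rpu : reduced (p ++ u) by rewrite -eg fg_reduced.
have rpv : reduced (p ++ v) by rewrite -eh fg_reduced.
have a1 := tree_backtrack rpu; have a2 := tree_backtrack rpv.
have a3 := tree_backtrack red.
have a1' := backtrack_le' rpu; have a2' := backtrack_le' rpv.
have a3' := backtrack_le' red.
have n1 : 0 <= backtrack D p u by apply: (len_gromov_ge0 lD).
have n2 : 0 <= backtrack D p v by apply: (len_gromov_ge0 lD).
have n3 : 0 <= backtrack D (word_inv u) v by apply: (len_gromov_ge0 lD).
have n1' : 0 <= backtrack D' p u by apply: (len_gromov_ge0 lD').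
have n2' : 0 <= backtrack D' p v by apply: (len_gromov_ge0 lD').
have n3' : 0 <= backtrack D' (word_inv u) v by apply: (len_gromov_ge0 lD').
have /ler_normlP[c1 c2] := length_close (reduced_catl rpu).
have lp := len_lb (fg_of p); rewrite size_fg_of ?(reduced_catl rpu) // in lp.
have K1 := K_ge1; have K0 : 0 < K by lra.
rewrite lerBlDr ler_pdivrMl // in lp.
set P := D (fg_of p) in lp c1 c2 *; set P' := D' (fg_of p) in c1 c2 *.
move: a1 a2 a3 a1' a2' a3' n1 n2 n3 n1' n2' n3'.
set b1 := backtrack D p u; set b2 := backtrack D p v.
set b3 := backtrack D (word_inv u) v.
set b1' := backtrack D' p u; set b2' := backtrack D' p v.
set b3' := backtrack D' (word_inv u) v => *.
have B0 := bt_bound_ge0.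
have err : eta * (1 + 6 * (size p)%:R) <=
    6 * K * eta * (P - b1 - b2 + b3) + (12 * K * (bt_bound + 2) + 6 * K ^+ 2 + 1).
  have h1 : eta * (1 + 6 * (size p)%:R) <= eta * (1 + 6 * (K * (P + K))).
    by rewrite ler_wpM2l // lerD2l ler_wpM2l.
  have h2 : eta * (6 * (K * (b1 + b2 + K)) + 1) <= 1 * (6 * (K * (b1 + b2 + K)) + 1).
    apply: ler_wpM2r => //; rewrite addr_ge0 // mulr_ge0 // mulr_ge0 ?(ltW K0) //; lra.
  have h3 : 0 <= 6 * K * eta * b3 by do 3 (apply: mulr_ge0 => //); exact: ltW.
  have h4 : K * (b1 + b2) <= K * (2 * (bt_bound + 2)).
    by rewrite ler_pM2l // /bt_bound; lra.
  apply: le_trans h1 _.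
  rewrite (_ : eta * (1 + _) = 6 * K * eta * (P - b1 - b2 + b3)
    - 6 * K * eta * b3 + eta * (6 * (K * (b1 + b2 + K)) + 1)); last ring.
  rewrite (_ : 1 * _ = 6 * (K * (b1 + b2)) + 6 * K ^+ 2 + 1) in h2; last ring.
  rewrite (_ : K * (2 * (bt_bound + 2)) = 2 * (K * (bt_bound + 2))) in h4; last ring.
  rewrite (_ : 12 * K * (bt_bound + 2) = 12 * (K * (bt_bound + 2))); last ring.
  by lra.
move: err; set E1 := 6 * K * eta * _; set E2 := eta * _ in c1 c2 *.
set E3 := 12 * K * _; set E4 := 6 * K ^+ 2 => err.
have eB : bt_bound = 5 * K ^+ 3 + K + 2 by [].
by apply/ler_normlP; split; lra.
Qed.

End Comparison.
End Tree.
End LengthFunctions.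

(** * Gromov products at infinity *)

Section CommonLimit.
Variables (R : realType) (I : Type) (G : I -> R -> R).

(** The limit is the supremum of the eventual lower bounds of any one of the
    functions; by hypothesis its values are, up to [e], such bounds for the others. *)
Lemma common_limit (i0 : I) :
  (forall i j e, 0 < e ->
    \forall s \near +oo, \forall t \near +oo, G i s <= G j t + e) ->
  exists l : \bar R, forall i, (G i t)%:E @[t --> +oo] --> l.
Proof.
move=> Gij.
pose S := [set M%:E | M in [set M | \forall t \near +oo, M <= G i0 t]].
have Sup M : (\forall t \near +oo, M <= G i0 t) -> (M%:E <= ereal_sup S)%E.
  by move=> hM; apply: ereal_sup_ubound; exists M.
have low i M : (M%:E < ereal_sup S)%E -> \forall t \near +oo, M <= G i t.
  case/ereal_sup_gt => _ [M' hM' <-]; rewrite lte_fin => MM'.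
  have e0 : 0 < M' - M by rewrite subr_gt0.
  have [s [h1 h2]] := filter_ex (filterI hM' (Gij i0 i _ e0)).
  by apply: filterS h2 => t; lra.
exists (ereal_sup S) => i.
case ES : (ereal_sup S) => [l| |].
- apply/fine_cvgP; split; first by near=> t.
  apply/cvgrPdist_le => e e0; near=> t => /=; apply/ler_normlP; split.
    have : G i t - e <= l.
      have h : \forall t' \near +oo, G i t <= G i0 t' + e by near: t; exact: Gij.
      rewrite -lee_fin -ES; apply: Sup; apply: filterS h => t'; lra.
    lra.
  have : l - e <= G i t.
    by near: t; apply: low; rewrite ES lte_fin; lra.
  lra.
- apply/cvgeyPge => A; near=> t; rewrite lee_fin; near: t.
  by apply: low; rewrite ES ltry.
- have [s h] := filter_ex (Gij i0 i0 1 ltr01).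
  have : ((G i0 s - 1)%:E <= ereal_sup S)%E by apply: Sup; apply: filterS h => t; lra.
  by rewrite ES.
Unshelve. all: by end_near. Qed.

End CommonLimit.

Section HyperbolicSpaces.
Variables (R : realType) (X : metricType R).
Implicit Types (o x y z : X) (c : ray X) (xi : boundary X).

(** Gromov's four-point condition, in a form free of minima. *)
Definition hyperbolic (delta : R) : Prop := forall m o x y z,
  m <= gromov o x y -> m <= gromov o y z -> m - delta <= gromov o x z.

(** The consequence of strict negative curvature that makes the Gromov product
    of boundary points independent of the rays representing them: asymptotic
    rays are strongly asymptotic, up to a shift of the time. *)
Definition ray_rigid : Prop := forall c c', asymptotic c c' ->
  exists a : R, forall e, 0 < e ->
    \forall t \near +oo, mdist (val c (t + a)) (val c' t) <= e.

(** Convergence of points to the endpoint of [c], in terms of the ray only. *)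
Definition converges_to o (x : nat -> X) c : Prop := forall M,
  \forall n \near \oo, \forall t \near +oo, M <= gromov o (x n) (val c t).

Definition gromov_complete : Prop := forall o (x : nat -> X),
  (forall M, exists n0, forall n m, (n0 <= n)%N -> (n0 <= m)%N ->
     M <= gromov o (x n) (x m)) ->
  exists c, converges_to o x c.

Lemma gromovC o x y : gromov o x y = gromov o y x.
Proof. by rewrite /gromov [mdist x y]metric_sym [mdist x o + _]addrC. Qed.

Lemma gromov_ge0 o x y : 0 <= gromov o x y.
Proof. by rewrite /gromov; have := metric_triangle x o y; rewrite (metric_sym o y); lra. Qed.

Lemma gromov_le o x y : gromov o x y <= mdist x o.
Proof. by rewrite /gromov; have := metric_triangle y x o; rewrite (metric_sym y x); lra. Qed.

Lemma ray_dist c s t : 0 <= s -> 0 <= t -> mdist (val c s) (val c t) = `|s - t|.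
Proof. by move=> s0 t0; have /asboolP := valP c; apply. Qed.

Lemma ray_busemann_le c x s t : 0 <= s -> s <= t ->
  mdist (val c t) x - t <= mdist (val c s) x - s.
Proof.
move=> s0 st; have := metric_triangle (val c t) (val c s) x.
rewrite ray_dist ?(le_trans s0) // ger0_norm ?subr_ge0 //; lra.
Qed.

(** The function [t |-> d(c t, x) - t] is nonincreasing and bounded below, with
    limit the Busemann function of [c] at [x]. *)
Lemma ray_busemann c x e : 0 < e -> \forall s \near +oo, forall t, 0 <= t ->
  mdist (val c s) x - s <= mdist (val c t) x - t + e.
Proof.
move=> e0; pose S := [set mdist (val c t) x - t | t in [set t | 0 <= t]].
have lbS : has_lbound S.
  exists (- mdist (val c 0) x) => _ [t t0 <-].
  have := metric_triangle (val c 0) x (val c t).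
  rewrite ray_dist // sub0r normrN (ger0_norm t0) (metric_sym x); lra.
have infS : has_inf S by split=> //; exists (mdist (val c 0) x - 0); exists 0 => //=.
have [_ [s0 /= s0_ge0 <-] hs0] := inf_adherent e0 infS.
near=> s => t t0.
have h1 : inf S <= mdist (val c t) x - t by apply: ge_inf => //; exists t.
have : mdist (val c s) x - s <= mdist (val c s0) x - s0 by apply: ray_busemann_le.
lra.
Unshelve. all: by end_near. Qed.

Lemma near_pinfty_shift (P : R -> Prop) (a : R) : (\forall t \near +oo, P t) ->
  \forall t \near +oo, P (t + a).
Proof.
move=> [M [Mr hM]]; exists (M - a); split; first exact: num_real.
by move=> t /= ht; apply: hM; lra.
Qed.

Section Rigid.
Hypothesis rigid : ray_rigid.

Lemma gromov_pt_cvg o x xi : exists l : R, forall c, (\pi_(boundary X) c)%qT = xi ->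
  gromov o x (val c t) @[t --> +oo] --> l.
Proof.
pose I := {c : ray X | (\pi_(boundary X) c)%qT = xi}.
have i0 : I by exists (repr xi); rewrite reprK.
have [|l hl] := @common_limit R I (fun i t => gromov o x (val (sval i) t)) i0.
  move=> [c hc] [c' hc'] e e0 /=.
  have /rigid[a hca] : asymptotic c c' by apply/eqmodP; rewrite hc hc'.
  have e2 : 0 < e / 2 by lra.
  near=> s.
  have s0 : 0 <= s by near: s; exact: nbhs_pinfty_ge.
  have bs : forall u, 0 <= u ->
      mdist (val c s) o - s <= mdist (val c u) o - u + e / 2.
    by near: s; exact: ray_busemann.
  near=> t.
  have tas : s <= t + a.
    by near: t; apply: (near_pinfty_shift (P := fun t => s <= t)); exact: nbhs_pinfty_ge.
  have d : mdist (val c (t + a)) (val c' t) <= e / 2 by near: t; exact: hca.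
  have b1 := bs (t + a) (le_trans s0 tas).
  have b2 := @ray_busemann_le c x s (t + a) s0 tas.
  have := metric_triangle (val c (t + a)) (val c' t) o.
  have := metric_triangle (val c' t) (val c (t + a)) x.
  rewrite (metric_sym (val c' t) (val c _)) /gromov (metric_sym x (val c s)).
  rewrite (metric_sym x (val c' t)); lra.
have {}hl c : (\pi_(boundary X) c)%qT = xi ->
    (gromov o x (val c t))%:E @[t --> +oo] --> l.
  by move=> hc; exact: (hl (exist _ c hc)).
have hr : (gromov o x (val (repr xi) t))%:E @[t --> +oo] --> l.
  by apply: hl; rewrite reprK.
have l_ge0 : (0 <= l)%E.
  by apply: (cvge_ge _ hr); apply: nearW => t; rewrite lee_fin gromov_ge0.
have l_le : (l <= (mdist x o)%:E)%E.
  by apply: (cvge_le _ hr); apply: nearW => t; rewrite lee_fin gromov_le.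
have lE : l = (fine l)%:E.
  by rewrite fineK // ge0_fin_numE // (le_lt_trans l_le) ?ltry.
by exists (fine l) => c /hl; rewrite lE => /fine_cvgP[].
Unshelve. all: by end_near. Qed.

(** The Gromov product of [c t] and [d t] is half the sum of two terms that
    converge to Busemann functions and of [2 t - d(c t, d t)], which is
    nondecreasing; a shift of the times compensates between the three terms. *)
Lemma gromov_bd_cvg o xi zeta : exists l : \bar R, forall c c',
  (\pi_(boundary X) c)%qT = xi -> (\pi_(boundary X) c')%qT = zeta ->
  (gromov o (val c t) (val c' t))%:E @[t --> +oo] --> l.
Proof.
pose I := {c : ray X * ray X |
  (\pi_(boundary X) c.1)%qT = xi /\ (\pi_(boundary X) c.2)%qT = zeta}.
have i0 : I by exists (repr xi, repr zeta); rewrite /= !reprK.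
have [|l hl] := @common_limit R I
    (fun i t => gromov o (val (sval i).1 t) (val (sval i).2 t)) i0; last first.
  by exists l => c c' hc hc'; exact: (hl (exist _ (c, c') (conj hc hc'))).
move=> [[c d] /= [hc hd]] [[c' d'] /= [hc' hd']] e e0 /=.
have /rigid[a hca] : asymptotic c c' by apply/eqmodP; rewrite hc hc'.
have /rigid[b hdb] : asymptotic d d' by apply/eqmodP; rewrite hd hd'.
have e3 : 0 < e / 3 by lra.
near=> s.
have s0 : 0 <= s by near: s; exact: nbhs_pinfty_ge.
have cs : forall u, 0 <= u ->
    mdist (val c s) o - s <= mdist (val c u) o - u + e / 3.
  by near: s; exact: ray_busemann.
have ds : forall u, 0 <= u ->
    mdist (val d s) o - s <= mdist (val d u) o - u + e / 3.
  by near: s; exact: ray_busemann.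
near=> t.
have tas : s <= t + a.
  by near: t; apply: (near_pinfty_shift (P := fun t => s <= t)); exact: nbhs_pinfty_ge.
have tbs : s <= t + b.
  by near: t; apply: (near_pinfty_shift (P := fun t => s <= t)); exact: nbhs_pinfty_ge.
have ca : mdist (val c (t + a)) (val c' t) <= e / 3 by near: t; exact: hca.
have db : mdist (val d (t + b)) (val d' t) <= e / 3 by near: t; exact: hdb.
have := cs (t + a) (le_trans s0 tas); have := ds (t + b) (le_trans s0 tbs).
have := metric_triangle (val c (t + a)) (val c' t) o.
have := metric_triangle (val d (t + b)) (val d' t) o.
have := metric_triangle (val c' t) (val c (t + a)) (val d' t).
have := metric_triangle (val c (t + a)) (val d (t + b)) (val d' t).
have := metric_triangle (val c (t + a)) (val c s) (val d (t + b)).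
have := metric_triangle (val c s) (val d s) (val d (t + b)).
rewrite !ray_dist // ?(le_trans s0) //.
rewrite [`|s - _|]distrC !ger0_norm ?subr_ge0 // (metric_sym (val c' t) (val c _)).
rewrite /gromov; lra.
Unshelve. all: by end_near. Qed.

Lemma gromov_ptP o x c :
  (gromov o x (val c t))%:E @[t --> +oo] --> gromov_pt o x (\pi_(boundary X) c)%qT.
Proof.
rewrite /gromov_pt; set P := (X in get X).
have [l hl] := gromov_pt_cvg o x (\pi_(boundary X) c)%qT.
have /getPex : exists l, P l.
  exists l%:E => c' /hl h; apply/fine_cvgP; split => //; exact: nearW.
exact.
Qed.

Lemma gromov_bdP o c c' :
  (gromov o (val c t) (val c' t))%:E @[t --> +oo] -->
  gromov_bd o (\pi_(boundary X) c)%qT (\pi_(boundary X) c')%qT.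
Proof.
rewrite /gromov_bd; set P := (X in get X).
have [l hl] := gromov_bd_cvg o (\pi_(boundary X) c)%qT (\pi_(boundary X) c')%qT.
have /getPex : exists l, P l by exists l.
by apply.
Qed.

Lemma near_gt_lim (f : R -> R) (l : \bar R) M :
  (f t)%:E @[t --> +oo] --> l -> (M%:E < l)%E -> \forall t \near +oo, M <= f t.
Proof.
move=> fl Ml; have h : \forall t \near +oo, (M%:E < (f t)%:E)%E.
  apply: (fl [set u | (M%:E < u)%E]); apply: open_nbhs_nbhs; split => //.
  exact: open_ereal_gt_ereal.
by apply: filterS h => t; rewrite lte_fin => /ltW.
Qed.

Lemma gromov_pt_convergesP o (x : nat -> X) c :
  gromov_pt o (x n) (\pi_(boundary X) c)%qT @[n --> \oo] --> +oo%E <->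
  converges_to o x c.
Proof.
split=> [/cvgeyPgt h M|h].
  by apply: filterS (h M) => n; apply: near_gt_lim; exact: gromov_ptP.
apply/cvgeyPge => M; apply: filterS (h M) => n hn.
have hl := @gromov_ptP o (x n) c; apply: (cvge_ge _ hl).
by apply: filterS hn => t; rewrite lee_fin.
Qed.

End Rigid.

Lemma converges_gromov_seq delta o (x : nat -> X) c : hyperbolic delta ->
  converges_to o x c -> forall M, exists n0, forall n m, (n0 <= n)%N ->
    (n0 <= m)%N -> M <= gromov o (x n) (x m).
Proof.
move=> hyp xc M; have [n0 _ h] := xc (M + delta).
exists n0 => n m nn nm.
have [t [h1 h2]] := filter_ex (filterI (h n nn) (h m nm)).
have := hyp (M + delta) o (x n) (val c t) (x m) h1.
by rewrite addrK; apply; rewrite gromovC.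
Qed.

End HyperbolicSpaces.

(** The quasi-ultrametric inequality compares the Gromov product of two
    boundary points with that of points converging to them. *)
Lemma gromov_approx (R : realType) (X : metricType R) (delta : R) (o : X)
    (x y : nat -> X) (c d : ray X) :
  hyperbolic X delta -> 0 <= delta -> converges_to o x c -> converges_to o y d ->
  (forall M, (\forall t \near +oo, M <= gromov o (val c t) (val d t)) ->
     \forall n \near \oo, M - 2 * delta <= gromov o (x n) (y n)) /\
  (forall M, (\forall n \near \oo, M <= gromov o (x n) (y n)) ->
     \forall t \near +oo, M - 2 * delta <= gromov o (val c t) (val d t)).
Proof.
move=> hyp delta0 xc yd; split=> M hM.
  near=> n.
  have h1 : \forall t \near +oo, M <= gromov o (x n) (val c t) by near: n; exact: xc.
  have h2 : \forall t \near +oo, M <= gromov o (y n) (val d t) by near: n; exact: yd.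
  have [t [[h3 h4] h5]] := filter_ex (filterI (filterI h1 h2) hM).
  have h6 := hyp _ _ _ _ _ h3 h5.
  have h7 : M - delta <= gromov o (val d t) (y n) by rewrite gromovC; lra.
  by have := hyp _ _ _ _ _ h6 h7; lra.
have [n [[h1 h2] h3]] := filter_ex (filterI (filterI (xc M) (yd M)) hM).
apply: filterS (filterI h1 h2) => t [h4 h5].
rewrite gromovC in h4.
have h6 := hyp _ _ _ _ _ h4 h3.
have h7 : M - delta <= gromov o (y n) (val d t) by lra.
by have := hyp _ _ _ _ _ h6 h7; lra.
Unshelve. all: by end_near. Qed.

(** * Hausdorff dimension and Hoelder correspondences *)

Section Holder.
Local Open Scope ereal_scope.
Variables (R : realType) (E E' : Type).
Variables (delta : E -> E -> \bar R) (delta' : E' -> E' -> \bar R).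

Lemma diameter_ge0 (F : Type) (d : F -> F -> \bar R) U : 0 <= diameter d U.
Proof. by apply: ereal_sup_ubound; left. Qed.

Lemma hausdorff_premeasure_ge0 (F : Type) (d : F -> F -> \bar R) s eps A :
  0 <= hausdorff_premeasure d s eps A.
Proof.
apply: le_ereal_inf_tmp => _ [U _ <-]; apply: nneseries_ge0 => n _ _.
exact: poweR_ge0.
Qed.

Lemma hausdorff_measure0P (F : Type) (d : F -> F -> \bar R) s A :
  hausdorff_measure d s A = 0 <->
  forall eps eta : R, (0 < eps)%R -> (0 < eta)%R ->
    exists U : nat -> set F, [/\ A `<=` \bigcup_n U n,
      forall n, diameter d (U n) <= eps%:E &
      \sum_(n <oo) diameter d (U n) `^ s <= eta%:E].
Proof.
split=> [h eps eta eps0 eta0|h].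
  have : hausdorff_premeasure d s eps A < eta%:E.
    apply: (@le_lt_trans _ _ 0); last by rewrite lte_fin.
    by rewrite -h; apply: ereal_sup_ubound; exists eps.
  case/ereal_inf_lt => _ [U [AU dU] <-] /ltW hU.
  by exists U.
apply/eqP; rewrite eq_le; apply/andP; split; last first.
  apply: le_trans (hausdorff_premeasure_ge0 d s 1 A) _.
  by apply: ereal_sup_ubound; exists 1%R => //=; rewrite ltr01.
apply: ge_ereal_sup => _ [eps /= eps0 <-].
apply/lee_addgt0Pr => eta eta0; rewrite add0e.
have [U [AU dU hU]] := h eps eta eps0 eta0.
by apply: le_trans hU; apply: ereal_inf_lbound; exists U.
Qed.

Variables (A : set E) (A' : set E') (rel : E -> E' -> Prop) (alpha C : R).
Hypotheses (alpha_gt0 : (0 < alpha)%R) (C_gt0 : (0 < C)%R).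
Hypothesis delta_ge0 : forall a b, 0 <= delta a b.
Hypothesis rel_onto : forall a', A' a' -> exists2 a, A a & rel a a'.
Hypothesis rel_holder : forall a b a' b', rel a a' -> rel b b' ->
  delta' a' b' <= C%:E * delta a b `^ alpha.

(** The images of the members of a covering of [A] cover [A'], and the [s / alpha]
    powers of their diameters are bounded, up to a constant factor, by the [s]
    powers of the diameters of the original ones. *)
Lemma Hdim_holder : alpha%:E * Hdim delta' A' <= Hdim delta A.
Proof.
apply: le_ereal_inf_tmp => _ [s [s0 /hausdorff_measure0P hs] <-].
have sa0 : (0 < s / alpha)%R by rewrite divr_gt0.
suff h : hausdorff_measure delta' (s / alpha) A' = 0.
  have -> : s%:E = alpha%:E * (s / alpha)%:E.
    by rewrite -EFinM mulrC divfK ?gt_eqF.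
  by rewrite lee_pmul2l ?lte_fin //; apply: ereal_inf_lbound; exists (s / alpha)%R.
apply/hausdorff_measure0P => eps eta eps0 eta0.
pose eps1 := ((eps / C) `^ alpha^-1)%R.
have eps1_gt0 : (0 < eps1)%R by rewrite powR_gt0 // divr_gt0.
pose K := (C `^ (s / alpha))%R.
have K0 : (0 < K)%R by rewrite powR_gt0.
have [U [AU dU sU]] := hs eps1 (eta / K)%R eps1_gt0 (divr_gt0 eta0 K0).
pose V n := [set a' | exists2 a, U n a & rel a a'].
have dV n : diameter delta' (V n) <= C%:E * diameter delta (U n) `^ alpha.
  apply: ge_ereal_sup => _ [->|[x [a Ua ax] [y [b Ub bx] <-]]].
    by rewrite mule_ge0 ?poweR_ge0 // lee_fin ltW.
  apply: le_trans (rel_holder ax bx) _.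
  rewrite lee_pmul2l ?lte_fin //; apply: (gt0_ler_poweR (ltW alpha_gt0)).
  - by rewrite in_itv /= delta_ge0 leey.
  - by rewrite in_itv /= diameter_ge0 leey.
  - by apply: ereal_sup_ubound; right; exists a => //; exists b.
exists V; split.
- move=> a' /rel_onto[a /AU[n _ Una] aa']; exists n => //.
  by exists a.
- move=> n; apply: le_trans (dV n) _.
  have -> : eps%:E = C%:E * eps1%:E `^ alpha.
    rewrite poweR_EFin -powRrM mulVf ?gt_eqF // powRr1 ?divr_ge0 ?ltW //.
    by rewrite -EFinM mulrC divfK ?gt_eqF.
  rewrite lee_pmul2l ?lte_fin //; apply: (gt0_ler_poweR (ltW alpha_gt0)).
  - by rewrite in_itv /= diameter_ge0 leey.
  - by rewrite in_itv /= lee_fin (ltW eps1_gt0) leey.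
  - exact: dU.
- apply: (@le_trans _ _ (\sum_(n <oo) K%:E * diameter delta (U n) `^ s)).
    apply: lee_nneseries => [n _ _|n _]; first exact: poweR_ge0.
    have -> : K%:E * diameter delta (U n) `^ s =
        (C%:E * diameter delta (U n) `^ alpha) `^ (s / alpha).
      rewrite poweRM ?poweR_ge0 ?lee_fin ?ltW // poweR_EFin -poweRrM.
      by rewrite (mulrC alpha) divfK ?gt_eqF.
    apply: (gt0_ler_poweR (ltW sa0)); rewrite ?in_itv /= ?diameter_ge0 ?leey //.
    by rewrite mule_ge0 ?poweR_ge0 // lee_fin ltW.
  rewrite nneseriesZl => [|n _]; last exact: poweR_ge0.
  apply: le_trans (lee_wpmul2l _ sU) _; first by rewrite lee_fin ltW.
  by rewrite -EFinM mulrC divfK ?gt_eqF.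
Qed.

End Holder.

Section CompareOrbits.
Variables (R : realType) (X Y : metricType R) (G : Type).
Variables (p : G -> X) (q : G -> Y) (oX : X) (oY : Y).

(** The definition of a limit set for arbitrary families of points: only the
    indexing by the same set matters in the comparison of two orbits. *)
Definition orbit_limit (Z : metricType R) (f : G -> Z) (o : Z) : set (boundary Z) :=
  [set xi | exists g : nat -> G, gromov_pt o (f (g n)) xi @[n --> \oo] --> +oo%E].

Variables (deltaX deltaY alpha beta C C' : R).
Hypotheses (hypX : hyperbolic X deltaX) (hypY : hyperbolic Y deltaY).
Hypotheses (deltaX_ge0 : 0 <= deltaX) (deltaY_ge0 : 0 <= deltaY).
Hypotheses (rigidX : ray_rigid X) (rigidY : ray_rigid Y).
Hypothesis completeX : gromov_complete X.
Hypotheses (alpha_gt0 : 0 < alpha) (beta_gt0 : 0 < beta).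
Hypothesis lowerY : forall g h,
  alpha * gromov oX (p g) (p h) - C <= gromov oY (q g) (q h).
Hypothesis lowerX : forall g h,
  beta * gromov oY (q g) (q h) - C' <= gromov oX (p g) (p h).

(** The correspondence between the boundaries: [xi] and [zeta] are limits of one and
    the same sequence of indices. *)
Let rel (xi : boundary X) (zeta : boundary Y) : Prop := exists g : nat -> G,
  gromov_pt oX (p (g n)) xi @[n --> \oo] --> +oo%E /\
  gromov_pt oY (q (g n)) zeta @[n --> \oo] --> +oo%E.

(** A sequence converging in [Y] is a Gromov sequence in [X], by [lowerX]. *)
Let rel_onto zeta : orbit_limit q oY zeta ->
  exists2 xi, orbit_limit p oX xi & rel xi zeta.
Proof.
move=> [g hg].
have qg : converges_to oY (fun n => q (g n)) (repr zeta).
  by apply/(gromov_pt_convergesP rigidY); rewrite reprK.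
have [M|c xc] := completeX (o := oX) (x := fun n => p (g n)).
  have [n0 h] := converges_gromov_seq hypY qg ((M + C') / beta).
  exists n0 => n m nn nm; apply: le_trans (lowerX _ _).
  by rewrite lerBrDr mulrC -ler_pdivrMr // h.
have pg := (gromov_pt_convergesP rigidX oX (fun n => p (g n)) c).2 xc.
exists (\pi_(boundary X) c)%qT; first by exists g.
by exists g.
Qed.

Let B := alpha * (2 * deltaX) + C + 2 * deltaY.

Let rel_lower xi xi' zeta zeta' M : rel xi zeta -> rel xi' zeta' ->
  (M%:E < gromov_bd oX xi xi')%E ->
  ((alpha * M - B)%:E <= gromov_bd oY zeta zeta')%E.
Proof.
rewrite -[xi]reprK -[xi']reprK -[zeta]reprK -[zeta']reprK.
move: (repr xi) (repr xi') (repr zeta) (repr zeta') => c c' d d'.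
move=> [g [/(gromov_pt_convergesP rigidX) pg /(gromov_pt_convergesP rigidY) qg]].
move=> [h [/(gromov_pt_convergesP rigidX) ph /(gromov_pt_convergesP rigidY) qh]].
move/(near_gt_lim (@gromov_bdP _ _ rigidX oX c c')) => hM.
have [/(_ _ hM) h1 _] := gromov_approx hypX deltaX_ge0 pg ph.
have [_ h2] := gromov_approx hypY deltaY_ge0 qg qh.
have h3 : \forall n \near \oo, alpha * (M - 2 * deltaX) - C <=
    gromov oY (q (g n)) (q (h n)).
  apply: filterS h1 => n hn; apply: le_trans (lowerY _ _).
  by rewrite lerB // ler_pM2l.
have hl := @gromov_bdP _ _ rigidY oY d d'; apply: (cvge_ge _ hl).
apply: filterS (h2 _ h3) => t; rewrite lee_fin; apply: le_trans.
by rewrite le_eqVlt; apply/orP; left; apply/eqP; rewrite /B; ring.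
Qed.

Let rel_holder xi xi' zeta zeta' : rel xi zeta -> rel xi' zeta' ->
  (visual_dist oY zeta zeta' <=
   (expR B)%:E * visual_dist oX xi xi' `^ alpha)%E.
Proof.
move=> r1 r2; have := rel_lower r1 r2; rewrite /visual_dist.
case: (gromov_bd oX xi xi') => [l| |] low.
- have {}low : ((alpha * l - B)%:E <= gromov_bd oY zeta zeta')%E.
    case: (gromov_bd oY zeta zeta') low => [l'| |] low; last 2 first.
    + by rewrite leey.
    + by have := low (l - 1); rewrite lte_fin => /(_ ltac:(lra)).
    rewrite lee_fin; apply/ler_addgt0Pr => e e0.
    have := low (l - e / alpha); rewrite lte_fin ltrBlDr ltrDl divr_gt0 //.
    by move=> /(_ isT); rewrite lee_fin mulrBr mulrCA divff ?gt_eqF // mulr1; lra.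
  rewrite /= -expRM -EFinM -expRD.
  have -> : (expR (B + - l * alpha))%:E = expeR (- (alpha * l - B)%:E).
    by rewrite /=; congr (expR _)%:E; ring.
  by rewrite ler_expeR leeN2.
- have -> : gromov_bd oY zeta zeta' = +oo%E.
    apply/eqyP => A A0; have := low ((A + B) / alpha); rewrite ltry.
    by move=> /(_ isT); rewrite mulrC divfK ?gt_eqF // addrK.
  by rewrite /= mule_ge0 ?poweR_ge0 // lee_fin expR_ge0.
- by rewrite /= gt_eqF // gt0_muley ?leey // lte_fin expR_gt0.
Qed.

Lemma Hdim_orbit_limit_le :
  (alpha%:E * Hdim (visual_dist oY) (orbit_limit q oY) <=
   Hdim (visual_dist oX) (orbit_limit p oX))%E.
Proof.
apply: (Hdim_holder alpha_gt0 (expR_gt0 B)) rel_onto _.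
  by move=> xi xi'; exact: expeR_ge0.
by move=> *; exact: rel_holder.
Qed.

End CompareOrbits.

(** * Real hyperbolic space *)

Section Cosh.
Variable R : realType.
Implicit Types s t : R.

Definition cosh t : R := (expR t + expR (- t)) / 2.
Definition sinh t : R := (expR t - expR (- t)) / 2.

Lemma coshN t : cosh (- t) = cosh t.
Proof. by rewrite /cosh opprK addrC. Qed.

Lemma cosh0 : cosh 0 = 1.
Proof. by rewrite /cosh oppr0 expR0; field. Qed.

Lemma sinh0 : sinh 0 = 0.
Proof. by rewrite /sinh oppr0 expR0; field. Qed.

Lemma cosh_abs t : cosh `|t| = cosh t.
Proof. by case: (ger0P t) => // _; rewrite coshN. Qed.

Lemma coshB s t : cosh (s - t) = cosh s * cosh t - sinh s * sinh t.
Proof.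
rewrite /cosh /sinh opprB !expRD !expRN.
by field; rewrite !gt_eqF ?expR_gt0.
Qed.

Lemma cosh2_sinh2 t : cosh t ^+ 2 - sinh t ^+ 2 = 1.
Proof. by rewrite !expr2 -coshB subrr cosh0. Qed.

Lemma ler_cosh s t : 0 <= s -> 0 <= t -> (cosh s <= cosh t) = (s <= t).
Proof.
suff lt_cosh a b : 0 <= a -> a < b -> cosh a < cosh b.
  move=> s0 t0; apply/idP/idP; last first.
    by rewrite le_eqVlt => /predU1P[->//|/lt_cosh h]; apply/ltW/h.
  by apply: contraTT; rewrite -!ltNge => /lt_cosh; apply.
move=> a0 ab; have b0 : 0 < b by apply: le_lt_trans ab.
rewrite -subr_gt0.
have -> : cosh b - cosh a =
    (expR b - expR a) * (1 - expR (- a) * expR (- b)) / 2.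
  by rewrite /cosh !expRN; field; rewrite !gt_eqF ?expR_gt0.
rewrite divr_gt0 // mulr_gt0 // ?subr_gt0 ?ltr_expR // -expRD -[ltRHS]expR0.
by rewrite ltr_expR; lra.
Qed.

Lemma cosh_gt1 t : 0 < t -> 1 < cosh t.
Proof. by move=> t0; rewrite -cosh0 ltNge ler_cosh ?(ltW t0) // -ltNge. Qed.

Lemma cosh_inj s t : 0 <= s -> 0 <= t -> cosh s = cosh t -> s = t.
Proof.
by move=> s0 t0 st; apply/eqP; rewrite eq_le -(ler_cosh s0 t0) -(ler_cosh t0 s0) st lexx.
Qed.

Lemma sinh_gt0 t : 0 < t -> 0 < sinh t.
Proof. by move=> t0; rewrite divr_gt0 // subr_gt0 ltr_expR; lra. Qed.

Lemma expR_growth (p K : R) :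
  (forall t, 0 <= t -> expR t * p <= K) -> p <= 0.
Proof.
move=> h; rewrite leNgt; apply/negP => p0.
have t0 : 0 <= `|K| / p by rewrite divr_ge0 // ltW.
have := h _ t0; have := expR_ge1Dx (`|K| / p).
rewrite -(ler_pM2r p0) mulrDl divfK ?gt_eqF // mul1r.
by have := ler_norm K; lra.
Qed.

End Cosh.

Section HyperbolicSpace.
Variables (R : realType) (N : nat).
Local Notation V := 'rV[R]_N.+1.
Local Notation H := (hyp R N).
Implicit Types (x y z o : H) (u v w : V).

Lemma lorentzDl (a b : R) u v w :
  lorentz (a *: u + b *: v) w = a * lorentz u w + b * lorentz v w.
Proof.
rewrite (_ : a *: u + b *: v = a *: u - (- b) *: v) ?lorentzBl; last first.
  by rewrite scaleNr opprK.
by rewrite mulNr opprK.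
Qed.

Lemma lorentzDr (a b : R) u v w :
  lorentz w (a *: u + b *: v) = a * lorentz w u + b * lorentz w v.
Proof. by rewrite ![lorentz w _]lorentzC lorentzDl. Qed.

Lemma expR_dist x y :
  expR (mdist x y) = - lorentz x y + Num.sqrt ((- lorentz x y) ^+ 2 - 1).
Proof.
have h := hyp_ge1 x y; have := sqrtr_ge0 ((- lorentz x y) ^+ 2 - 1) => h'.
rewrite [mdist x y]/(hyp_dist x y) /hyp_dist /arcosh lnK // posrE.
by apply: lt_le_trans (arcosh_arg h).
Qed.

(** From here on distances are handled through their hyperbolic cosine. *)
Lemma lorentz_dist x y : - lorentz x y = cosh (mdist x y).
Proof.
rewrite /cosh expRN expR_dist; have h := hyp_ge1 x y.
set q := - lorentz x y in h *; set s := Num.sqrt _.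
have s0 : 0 <= s by exact: sqrtr_ge0.
have s2 : s ^+ 2 = q ^+ 2 - 1 by rewrite sqr_sqrtr // subr_ge0 exprn_ege1.
have -> : (q + s)^-1 = q - s.
  apply: (mulfI (x := q + s)); first by rewrite gt_eqF //; lra.
  rewrite mulfV ?gt_eqF //; last lra.
  rewrite (_ : (q + s) * (q - s) = q ^+ 2 - s ^+ 2); last by ring.
  by rewrite s2; ring.
by field.
Qed.

Lemma dist_lorentz x y t : - lorentz x y = cosh t -> mdist x y = `|t|.
Proof.
by rewrite lorentz_dist -(cosh_abs t) => /cosh_inj; apply; rewrite ?mdist_ge0.
Qed.

Lemma expR_dist_le x y : expR (mdist x y) <= 2 * - lorentz x y.
Proof.
rewrite lorentz_dist /cosh.
by have := expR_gt0 (- mdist x y); lra.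
Qed.

Lemma expR_dist_ge x y : - lorentz x y <= expR (mdist x y).
Proof. by rewrite expR_dist lerDl sqrtr_ge0. Qed.

(** In the projective (Klein) model centred at [o], where points are vectors [p]
    of norm less than one, [- lorentz x y / (lorentz x o * lorentz y o)] is
    [1 - p * q], that is, half the sum of [|p - q| ^ 2], [1 - |p| ^ 2] and
    [1 - |q| ^ 2]. The lemma rests on the inequality
    [|p - q| ^ 2 <= 2 * |p - m| ^ 2 + 2 * |m - q| ^ 2] for the first term. *)
Lemma lorentz_quasi_ultrametric o x y z :
  - lorentz x z * - lorentz y o <=
  2 * (- lorentz x y * - lorentz z o) + 2 * (- lorentz y z * - lorentz x o).
Proof.
have [[a1 b1] c1] := (hyp_ge1 x o, hyp_ge1 y o, hyp_ge1 z o).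
set a := - lorentz x o in a1 *; set b := - lorentz y o in b1 *.
set c := - lorentz z o in c1 *.
have ea : lorentz x o = - a by rewrite opprK.
have eb : lorentz y o = - b by rewrite opprK.
have ec : lorentz z o = - c by rewrite opprK.
have := @lorentz_orth_ge0 _ _ o
  (1 *: ((b * c) *: hyp_val x + (- 2 * a * c) *: hyp_val y) + (a * b) *: hyp_val z).
rewrite !lorentzDl !lorentzDr !hyp_lorentz ea eb ec.
rewrite (lorentzC y x) (lorentzC z x) (lorentzC z y).
set p := lorentz x y; set q := lorentz x z; set r := lorentz y z.
move=> /(_ ltac:(ring)) h.
have abc : 0 < 2 * a * b * c by rewrite !mulr_gt0 //; lra.
move: h; set S := (X in 0 <= X) => h.
rewrite -subr_ge0 -(pmulr_rge0 _ abc) (_ : 2 * a * b * c * _ =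
  S + ((b * c) ^+ 2 + 4 * (a * c) ^+ 2 + (a * b) ^+ 2)); last by rewrite /S; ring.
have := sqr_ge0 (b * c); have := sqr_ge0 (a * c); have := sqr_ge0 (a * b).
lra.
Qed.

Lemma gromov_lorentz_le m o x y : m <= gromov o x y ->
  - lorentz x y * expR (2 * m) <= 4 * (- lorentz x o * - lorentz y o).
Proof.
move=> h; have [x1 y1] := (hyp_ge1 x o, hyp_ge1 y o).
have e : expR (mdist x y) * expR (2 * m) <= expR (mdist x o) * expR (mdist y o).
  by rewrite -!expRD ler_expR; move: h; rewrite /gromov; lra.
apply: le_trans (le_trans e _).
  by rewrite ler_pM2r ?expR_gt0 ?expR_dist_ge.
rewrite (_ : 4 * _ = (2 * - lorentz x o) * (2 * - lorentz y o)); last by ring.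
by apply: ler_pM; rewrite ?expR_ge0 ?expR_dist_le.
Qed.

Lemma gromov_lorentz_ge m o x y :
  2 * - lorentz x y * expR (2 * m) <= - lorentz x o * - lorentz y o ->
  m <= gromov o x y.
Proof.
move=> h; have [x1 y1] := (hyp_ge1 x o, hyp_ge1 y o).
have : expR (mdist x y) * expR (2 * m) <= expR (mdist x o) * expR (mdist y o).
  apply: le_trans (le_trans _ h) _; first by rewrite ler_pM2r ?expR_gt0 ?expR_dist_le.
  by apply: ler_pM; rewrite ?expR_dist_ge //; lra.
by rewrite -!expRD ler_expR /gromov; lra.
Qed.

(** The exponential of [- 2 * gromov o x y] agrees, up to factors 2 and 4, with the
    function of [lorentz_quasi_ultrametric]; 32 is the product of these factors
    and of the 4 of that inequality. *)
Definition hyp_delta : R := ln 32 / 2.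

Lemma hyp_delta_ge0 : 0 <= hyp_delta.
Proof. by rewrite divr_ge0 // ln_ge0 // ler1n. Qed.

Lemma hyp_hyperbolic : hyperbolic H hyp_delta.
Proof.
move=> m o x y z hxy hyz; apply: gromov_lorentz_ge.
have [[x1 y1] z1] := (hyp_ge1 x o, hyp_ge1 y o, hyp_ge1 z o).
rewrite (_ : 2 * (m - hyp_delta) = 2 * m - ln 32); last by rewrite /hyp_delta; field.
rewrite expRD expRN lnK ?posrE ?ltr0n //.
have := gromov_lorentz_le hxy; have := gromov_lorentz_le hyz.
have := lorentz_quasi_ultrametric o x y z.
set E := expR (2 * m); have E0 : 0 < E by exact: expR_gt0.
set a := - lorentz x o in x1 *; set b := - lorentz y o in y1 *.
set c := - lorentz z o in z1 *; set p := - lorentz x y; set q := - lorentz y z.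
set r := - lorentz x z => h0 h1 h2.
have [a0 b0 c0] : [/\ 0 < a, 0 < b & 0 < c] by split; lra.
have g1 : c * (p * E) <= c * (4 * (a * b)) by rewrite ler_pM2l.
have g2 : a * (q * E) <= a * (4 * (b * c)) by rewrite ler_pM2l.
have g3 : r * b * E <= (2 * (p * c) + 2 * (q * a)) * E by rewrite ler_pM2r.
rewrite -(ler_pM2r b0).
rewrite (_ : 2 * r * (E / 32) * b = r * b * E / 16); last by field.
rewrite (_ : (2 * (p * c) + 2 * (q * a)) * E = 2 * (c * (p * E)) + 2 * (a * (q * E))) in g3;
  last by ring.
rewrite (_ : c * (4 * (a * b)) = 4 * (a * c * b)) in g1; last by ring.
rewrite (_ : a * (4 * (b * c)) = 4 * (a * c * b)) in g2; last by ring.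
lra.
Qed.

(** The point at distance [t] from [x] in the unit direction [u]. *)
Lemma hyp_geod_subproof x u t : lorentz u x = 0 -> lorentz u u = 1 ->
  let y := cosh t *: hyp_val x + sinh t *: u in
  (lorentz y y == -1) && (0 < y ord0 ord0).
Proof.
move=> ux uu /=; apply/andP; split.
  rewrite lorentzDl !lorentzDr hyp_lorentz uu ux (lorentzC x u) ux.
  apply/eqP; transitivity (- (cosh t ^+ 2 - sinh t ^+ 2)); first by ring.
  by rewrite cosh2_sinh2.
have [l u0 ul] := lorentz_orth ux.
have x0 := hyp_gt0 x; rewrite !mxE u0 mulrA -mulrDl mulr_gt0 //.
have l1 : l ^+ 2 <= 1 ^+ 2.
  by rewrite expr1n -uu ul lerDr spatial_ge0.
have {}l1 : `|l| <= 1 by rewrite -(ler_pXn2r (n := 2)) ?nnegrE // real_normK ?num_real.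
have hs : `|sinh t| < cosh t.
  have := expR_gt0 t; have := expR_gt0 (- t); rewrite /sinh /cosh ltr_norml => *.
  by apply/andP; split; lra.
have : `|sinh t * l| <= `|sinh t| by rewrite normrM ler_piMr.
by have := ler_norm (- (sinh t * l)); rewrite normrN; lra.
Qed.

Definition hyp_geod x u (ux : lorentz u x = 0) (uu : lorentz u u = 1) t : H :=
  Hyp (hyp_geod_subproof t ux uu).

Lemma hyp_geod_dist x u (ux : lorentz u x = 0) (uu : lorentz u u = 1) s t :
  mdist (hyp_geod ux uu s) (hyp_geod ux uu t) = `|s - t|.
Proof.
apply: dist_lorentz => /=.
rewrite lorentzDl !lorentzDr hyp_lorentz uu ux (lorentzC x u) ux coshB.
by ring.
Qed.

Definition geodesic_space (X : metricType R) : Prop := forall x y : X,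
  exists c : R -> X, [/\ c 0 = x, c (mdist x y) = y & forall s t,
    0 <= s <= mdist x y -> 0 <= t <= mdist x y -> mdist (c s) (c t) = `|s - t| ].

Lemma unit_direction x y (D : R) : 0 < D -> - lorentz x y = cosh D ->
  let u := (sinh D)^-1 *: hyp_val y + (- (cosh D / sinh D)) *: hyp_val x in
  lorentz u x = 0 /\ lorentz u u = 1.
Proof.
move=> D0 xy /=; have s0 := sinh_gt0 D0.
have {}xy : lorentz x y = - cosh D by rewrite -xy opprK.
rewrite !lorentzDl !lorentzDr !hyp_lorentz (lorentzC y x) xy; split.
  by field; rewrite gt_eqF.
have e := cosh2_sinh2 D.
rewrite [LHS](_ : _ = (cosh D ^+ 2 - 1) / sinh D ^+ 2); last by field; rewrite gt_eqF.
rewrite (_ : cosh D ^+ 2 - 1 = sinh D ^+ 2) ?divff ?expf_neq0 ?gt_eqF //.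
by rewrite -e; ring.
Qed.

Lemma hyp_geodesic : geodesic_space H.
Proof.
move=> x y; have [xy|nxy] := eqVneq x y.
  exists (fun=> x); split=> // s t; rewrite -xy mdistxx => s0 t0.
  have [-> ->] : s = 0 /\ t = 0 by lra.
  by rewrite subrr normr0.
have D0 : 0 < mdist x y.
  by rewrite lt_neqAle mdist_ge0 andbT eq_sym; apply: contra nxy => /eqP/mdist_positivity->.
have [ux uu] := unit_direction D0 (lorentz_dist x y).
exists (hyp_geod ux uu); split=> [||s t _ _]; last exact: hyp_geod_dist.
  by apply/val_inj; rewrite /= cosh0 sinh0 scale1r scale0r addr0.
apply/val_inj => /=; rewrite scalerDr !scalerA divff ?gt_eqF ?sinh_gt0 // scale1r.
rewrite addrCA -scalerDl mulrN mulrCA divff ?gt_eqF ?sinh_gt0 // mulr1 subrr.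
by rewrite scale0r addr0.
Qed.

(** The ray is the geodesic with null directions [u], its endpoint, and [v], the
    opposite one, chosen from [c 0] and [c 1]: the Lorentz products with these two
    points determine the difference of [c t] and the candidate point to be
    of norm zero and orthogonal to [c 0], hence zero. *)
Lemma ray_null_form (c : ray H) : exists u v : V,
  [/\ lorentz u u = 0, lorentz v v = 0, lorentz u v = - 2,
    lorentz u (val c 0) = - 1 &
    forall t, 0 <= t ->
      hyp_val (val c t) = (expR t / 2) *: u + (expR (- t) / 2) *: v].
Proof.
have cc s t : 0 <= s -> 0 <= t -> - lorentz (val c s) (val c t) = cosh (s - t).
  by move=> s0 t0; rewrite lorentz_dist ray_dist // cosh_abs.
have s1 : sinh 1 != 0 :> R by rewrite gt_eqF ?sinh_gt0.
set x := val c 0; have c01 : - lorentz x (val c 1) = cosh 1.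
  by rewrite cc // sub0r coshN.
have [y [yx yy c1E]] : exists y : V, [/\ lorentz y x = 0, lorentz y y = 1 &
    hyp_val (val c 1) = cosh 1 *: hyp_val x + sinh 1 *: y].
  have [h1 h2] := unit_direction ltr01 c01; eexists; split; [exact: h1|exact: h2|].
  rewrite scalerDr !scalerA divff // scale1r mulrN mulrCA divff // mulr1.
  by rewrite scaleNr addrC subrK.
have xx : lorentz x x = - 1 by exact: hyp_lorentz.
exists (1 *: hyp_val x + 1 *: y), (1 *: hyp_val x + (- 1) *: y).
rewrite !lorentzDl !lorentzDr (lorentzC x y) yx yy xx.
split; [by ring|by ring|by ring|by ring|] => t t0.
have e : (expR t / 2) *: (1 *: hyp_val x + 1 *: y) +
    (expR (- t) / 2) *: (1 *: hyp_val x + (- 1) *: y) =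
    cosh t *: hyp_val x + sinh t *: y.
  by apply/rowP => j; rewrite !mxE /cosh /sinh; field.
rewrite e; apply/eqP; rewrite -subr_eq0 -[val c t : V]scale1r -[X in _ - X]scale1r.
set z := cosh t *: _ + _.
have zx : lorentz z x = - cosh t by rewrite lorentzDl yx xx; ring.
have zz : lorentz z z = - 1.
  rewrite lorentzDl !lorentzDr (lorentzC x y) yx yy xx.
  transitivity (- (cosh t ^+ 2 - sinh t ^+ 2)); first by ring.
  by rewrite cosh2_sinh2.
have tx : lorentz (val c t) x = - cosh t.
  by rewrite -[LHS]opprK cc // subr0.
have t1 : lorentz (val c t) (val c 1) = - cosh (t - 1).
  by rewrite -[LHS]opprK cc.
have ty : lorentz (val c t) y = sinh t.
  by apply: (mulfI s1); move: t1; rewrite c1E lorentzDr tx coshB; lra.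
have tz : lorentz (val c t) z = - 1.
  rewrite lorentzDr tx ty; transitivity (- (cosh t ^+ 2 - sinh t ^+ 2)).
    by ring.
  by rewrite cosh2_sinh2.
apply/eqP/(@lorentz_orth_eq0 _ _ x); first by rewrite lorentzBl zx tx; ring.
rewrite lorentzBl !lorentzBr (lorentzC z (val c t)) tz zz hyp_lorentz.
by ring.
Qed.

(** Along two asymptotic rays the hyperbolic cosine of the distance stays bounded,
    which forces the null vectors of their endpoints to be orthogonal, hence
    proportional. The shift by the logarithm of the factor of proportionality
    makes the constant term of this hyperbolic cosine equal to one. *)
Lemma hyp_rigid : ray_rigid H.
Proof.
move=> c c' /asboolP[M cM].
have [u [v [uu vv uv u0 cE]]] := ray_null_form c.
have [u' [v' [uu' vv' uv' u0' cE']]] := ray_null_form c'.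
have M0 : 0 <= M by apply: le_trans (cM 0 (lexx 0)); rewrite mdist_ge0.
have lE s t : 0 <= s -> 0 <= t -> - lorentz (val c s) (val c' t) =
    - (expR (s + t) * lorentz u u' + expR (s - t) * lorentz u v'
      + expR (t - s) * lorentz v u' + expR (- (s + t)) * lorentz v v') / 4.
  move=> s0 t0; rewrite (cE s s0) (cE' t t0) lorentzDl !lorentzDr.
  by rewrite (opprD s t) !expRD; field.
have exp_le1 t : 0 <= t -> expR (- t) <= 1 :> R.
  by move=> t0; rewrite -[leRHS]expR0 ler_expR; lra.
have bound t : 0 <= t -> `|expR (- (t + t)) * lorentz v v'| <= `|lorentz v v'|.
  move=> t0; rewrite normrM ler_piMl // ger0_norm ?expR_ge0 // exp_le1 //; lra.
(* the factor of expR (2 t) must vanish, the distance being bounded *)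
have nuu' : lorentz u u' = 0.
  have grow (p K : R) : (forall t, 0 <= t -> expR (t + t) * p <= K) -> p <= 0.
    move=> h; apply: (@expR_growth _ p K) => t t0.
    have := h (t / 2) ltac:(lra); congr (_ <= _); congr (expR _ * _); lra.
  apply/eqP; rewrite eq_le; apply/andP; split.
    apply: (grow _ (- 4 - lorentz u v' - lorentz v u' + `|lorentz v v'|)) => t t0.
    have := hyp_ge1 (val c t) (val c' t); rewrite lE // subrr expR0.
    by have /ler_normlP[] := bound t t0; lra.
  rewrite -oppr_le0.
  apply: (grow _ (4 * cosh M + lorentz u v' + lorentz v u' + `|lorentz v v'|)) => t t0.
  have : - lorentz (val c t) (val c' t) <= cosh M.
    by rewrite lorentz_dist ler_cosh ?mdist_ge0 ?cM.
  rewrite lE // subrr expR0.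
  by have /ler_normlP[] := bound t t0; lra.
(* a null vector orthogonal to u differs from a multiple of u by a vector
   orthogonal to c 0 and of norm zero *)
set l := - lorentz u' (val c 0).
have u'E : u' = l *: u.
  apply/eqP; rewrite -subr_eq0 -[u' in u' - _]scale1r; apply/eqP.
  apply: (@lorentz_orth_eq0 _ _ (val c 0)); first by rewrite lorentzBl u0 /l; ring.
  by rewrite lorentzBl !lorentzBr uu uu' (lorentzC u') nuu'; ring.
have lv : l * lorentz u v' = - 2.
  have := lorentzDl l 0 u 0 v'; rewrite scale0r addr0 -u'E uv' mul0r addr0.
  by move=> <-.
have vu' : lorentz v u' = - 2 * l.
  have := lorentzDr l 0 u 0 v; rewrite scale0r addr0 -u'E mul0r addr0 (lorentzC v u) uv.
  by move=> ->; ring.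
have l0 : 0 < l.
  rewrite lt_neqAle; apply/andP; split.
    by apply: contra_eq_neq lv => <-; rewrite mul0r eq_sym oppr_eq0 pnatr_eq0.
  rewrite -oppr_le0; apply: (@expR_growth _ _ (`|lorentz v' (val c 0)|)) => t t0.
  have := hyp_ge1 (val c' t) (val c 0); rewrite (cE' t t0) lorentzDl.
  have h1 : `|expR (- t) * lorentz v' (val c 0)| <= `|lorentz v' (val c 0)|.
    by rewrite normrM ler_piMl // ger0_norm ?expR_ge0 // exp_le1.
  have /ler_normlP[h2 h3] := h1.
  by rewrite /l; lra.
exists (ln l) => e e0.
pose W := `|lorentz v v'|; have W0 : 0 <= W by exact: normr_ge0.
have e1 : 0 < cosh e - 1 by rewrite subr_gt0 cosh_gt1.
near=> t.
have t0 : 0 <= t by near: t; exact: nbhs_pinfty_ge.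
have tl : 0 <= t + ln l.
  by near: t; apply: (near_pinfty_shift (P := fun t => 0 <= t)); exact: nbhs_pinfty_ge.
have tW : W / (cosh e - 1) <= t + (t + ln l).
  have : W / (cosh e - 1) <= t + ln l; last lra.
  near: t; apply: (near_pinfty_shift (P := fun t => W / (cosh e - 1) <= t)).
  by apply: nbhs_pinfty_ge; exact: num_real.
rewrite -ler_cosh ?mdist_ge0 ?ltW // -lorentz_dist lE // nuu' mulr0 add0r.
rewrite (_ : t + ln l - t = ln l); last by ring.
rewrite (_ : t - (t + ln l) = - ln l); last by ring.
rewrite expRN lnK // lv vu'.
rewrite (_ : l^-1 * (- 2 * l) = - 2); last by field; rewrite gt_eqF.
suff : `|expR (- (t + ln l + t)) * lorentz v v'| <= cosh e - 1.
  by move=> /ler_normlP[]; lra.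
rewrite normrM ger0_norm ?expR_ge0 // expRN ler_pdivrMl ?expR_gt0 //.
move: tW; rewrite ler_pdivrMr // => tW; apply: le_trans tW _.
rewrite ler_pM2r //; have := expR_ge1Dx (t + ln l + t); lra.
Unshelve. all: by end_near. Qed.

End HyperbolicSpace.

Section HyperbolicComplete.
Variables (R : realType) (N : nat).
Local Notation V := 'rV[R]_N.+1.
Local Notation H := (hyp R N).

(** On the orthogonal of [o] the Lorentz form is a Euclidean norm, which bounds the
    coordinates: Cauchy sequences for this norm converge coordinatewise. *)
Lemma orth_coord_le (o : H) (w : V) j : lorentz w o = 0 ->
  `|w ord0 j| <= (1 + `|(o : V) ord0 j|) * Num.sqrt (lorentz w w).
Proof.
move=> wo; have [l w0 ->] := lorentz_orth wo.
set d := 1 *: w - _; set S := Num.sqrt _.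
have dd := spatial_ge0 d.
have lS : `|l| <= S by rewrite -sqrtr_sqr ler_wsqrtr // lerDr.
case: (unliftP ord0 j) => [i ->|->]; last first.
  rewrite w0 normrM mulrC ler_pM // lerDr.
  by [].
have di : `|d ord0 (lift ord0 i)| <= S.
  rewrite -sqrtr_sqr ler_wsqrtr // /spatial (bigD1 i) //= -expr2 -addrA lerDl.
  by rewrite addr_ge0 ?sqr_ge0 // sumr_ge0 // => k _; rewrite -expr2 sqr_ge0.
have -> : w ord0 (lift ord0 i) =
    d ord0 (lift ord0 i) + l * (o : V) ord0 (lift ord0 i).
  by rewrite !mxE; ring.
apply: le_trans (ler_normD _ _) _.
rewrite mulrDl mul1r lerD // normrM mulrC ler_wpM2l //.
Qed.

(** The points of a Gromov sequence, rescaled to the affine hyperplane of the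
    Klein model centred at [o], form a Cauchy sequence, whose limit is a null
    vector spanning the endpoint of the required ray. *)
Lemma hyp_complete : gromov_complete H.
Proof.
move=> o x xx.
pose p n : V := (- lorentz (x n) o)^-1 *: hyp_val (x n).
have q1 n : 1 <= - lorentz (x n) o := hyp_ge1 (x n) o.
have q0 n : 0 < - lorentz (x n) o by apply: lt_le_trans (q1 n).
have lZ a (u v : V) : lorentz (a *: u) v = a * lorentz u v.
  by have := lorentzDl a 0 u 0 v; rewrite scale0r addr0 mul0r addr0.
have lZr a (u v : V) : lorentz v (a *: u) = a * lorentz v u.
  by rewrite lorentzC lZ lorentzC.
have po n : lorentz (p n) o = - 1.
  by rewrite lZ; field; rewrite -oppr_eq0 gt_eqF.
have pp_lt (M : R) : exists n0, forall n m, (n0 <= n)%N -> (n0 <= m)%N ->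
    - lorentz (p n) (p m) <= 4 * expR (- (2 * M)).
  have [n0 h] := xx M; exists n0 => n m nn nm.
  have := gromov_lorentz_le (h n m nn nm).
  rewrite lZ lZr expRN ler_pdivlMr ?expR_gt0 // => e.
  rewrite -(ler_pM2l (q0 n)) -(ler_pM2l (q0 m)).
  rewrite [X in X <= _](_ : _ = - lorentz (x n) (x m) * expR (2 * M)); last first.
    have nq k : lorentz (x k) o != 0 by rewrite -oppr_eq0 gt_eqF.
    by field; rewrite !nq.
  by apply: le_trans e _; rewrite le_eqVlt; apply/orP; left; apply/eqP; ring.
have ppn n : lorentz (p n) (p n) <= 0.
  rewrite lZ lZr hyp_lorentz !mulrN1 mulrN oppr_le0 mulr_ge0 // invr_ge0 ltW //.
have cv j : cvg (p n ord0 j @[n --> \oo]).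
  apply: cauchy_cvg; apply: cauchy_exP => e e0.
  pose k := 1 + `|(o : V) ord0 j|; have k0 : 0 < k by rewrite ltr_pwDl.
  pose eta := e / k; have eta0 : 0 < eta by rewrite divr_gt0.
  have [n0 h] := pp_lt (- ln (eta ^+ 2 / 9) / 2).
  exists (p n0 ord0 j); exists n0 => // n /= nn; rewrite /ball /=.
  have po0 : lorentz (1 *: p n0 + (- 1) *: p n) o = 0.
    by rewrite lorentzDl !po; ring.
  have := orth_coord_le j po0; rewrite !mxE mul1r mulN1r => /le_lt_trans; apply.
  rewrite [ltRHS](_ : e = k * eta) ?ltr_pM2l //; last first.
    by rewrite /eta mulrC divfK ?gt_eqF.
  apply: (@lt_le_trans _ _ (Num.sqrt (eta ^+ 2))); last first.
    by rewrite sqrtr_sqr ger0_norm // ltW.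
  rewrite ltr_sqrt ?exprn_gt0 // lorentzDl !lorentzDr (lorentzC (p n)).
  have := h n0 n (leqnn _) nn; rewrite mulrCA divff // mulr1 opprK.
  rewrite lnK ?posrE ?divr_gt0 ?exprn_gt0 //.
  have := ppn n; have := ppn n0; have : 0 < eta ^+ 2 by rewrite exprn_gt0.
  lra.
pose u : V := \row_j lim (p n ord0 j @[n --> \oo]).
have pu j : p n ord0 j @[n --> \oo] --> u ord0 j by rewrite mxE; exact: cv.
have lor_cvg (a b : nat -> V) (a' b' : V) :
    (forall j, a n ord0 j @[n --> \oo] --> a' ord0 j) ->
    (forall j, b n ord0 j @[n --> \oo] --> b' ord0 j) ->
    lorentz (a n) (b n) @[n --> \oo] --> lorentz a' b'.
  move=> ha hb; apply: cvgB; last exact: cvgM.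
  apply: cvg_big => [|i _]; last exact: cvgM.
  by move=> z; apply: add_continuous.
have uo : lorentz u o = - 1.
  apply: (@cvg_unique _ (@Rhausdorff R) (lorentz (p n) o @[n --> \oo])).
    by apply: lor_cvg => // j; exact: cvg_cst.
  rewrite (_ : (fun n => lorentz (p n) o) = cst (- 1)); first exact: cvg_cst.
  by apply/funext => n; rewrite po.
have pu_lt (M : R) : exists n0, forall n, (n0 <= n)%N ->
    0 <= - lorentz (p n) u <= 4 * expR (- (2 * M)).
  have [n0 h] := pp_lt M; exists n0 => n nn.
  have hc : - lorentz (p n) (p m) @[m --> \oo] --> - lorentz (p n) u.
    by apply: cvgN; apply: lor_cvg => // j; exact: cvg_cst.
  apply/andP; split.
    apply: (cvgr_to_ge hc); apply: nearW => m.
    have i0 k : 0 <= (- lorentz (x k) o)^-1 by rewrite invr_ge0 ltW.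
    rewrite lZ lZr -!mulrN; apply: mulr_ge0 => //; apply: mulr_ge0 => //.
    exact/ltW/hyp_pos.
  by apply: (cvgr_to_le hc); exists n0 => // m /= nm; exact: h.
have uu : lorentz u u = 0.
  apply/eqP; rewrite -oppr_eq0 eq_le; apply/andP; split; last first.
    have hc : - lorentz (p n) (p n) @[n --> \oo] --> - lorentz u u.
      by apply: cvgN; exact: lor_cvg.
    by apply: (cvgr_to_ge hc); apply: nearW => n; rewrite oppr_ge0.
  apply/ler_addgt0Pl => e e0; rewrite addr0.
  have hc : - lorentz (p n) u @[n --> \oo] --> - lorentz u u.
    by apply: cvgN; apply: lor_cvg => // j; exact: cvg_cst.
  have [n0 h] := pu_lt (- ln (e / 4) / 2).
  apply: (cvgr_to_le hc); exists n0 => // n /= nn.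
  have /andP[_] := h n nn; rewrite mulrCA divff // mulr1 opprK.
  rewrite lnK ?posrE ?divr_gt0 //; lra.
pose y : V := 1 *: u + (- 1) *: hyp_val o.
have oo : lorentz o o = - 1 by exact: hyp_lorentz.
have yo : lorentz y o = 0 by rewrite lorentzDl uo oo; ring.
have yy : lorentz y y = 1.
  by rewrite lorentzDl !lorentzDr (lorentzC o u) uo oo uu; ring.
pose c := hyp_geod yo yy.
have rc : `[< is_ray c >] by apply/asboolP => s t _ _; exact: hyp_geod_dist.
exists (exist _ c rc) => M.
have [n0 h] := pu_lt (M + 2); exists n0 => // n /= nn.
have e2 : 2 <= expR 1 :> R by have := expR_ge1Dx (1 : R); lra.
near=> t.
have t0 : M + 2 <= t by near: t; apply: nbhs_pinfty_ge; exact: num_real.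
have tt0 : 0 <= t by near: t; exact: nbhs_pinfty_ge.
apply: gromov_lorentz_ge => /=.
have -> : - lorentz (cosh t *: hyp_val o + sinh t *: y) o = cosh t.
  by rewrite lorentzDl yo oo; ring.
have -> : - lorentz (x n) (cosh t *: hyp_val o + sinh t *: y) =
    - lorentz (x n) o * (expR t / 2 * - lorentz (p n) u
      + expR (- t) / 2 * (2 - - lorentz (p n) u)).
  rewrite lorentzDr /y lorentzDr lZ /cosh /sinh; field.
  by rewrite -oppr_eq0 gt_eqF.
have /andP[f0 f1] := h n nn; set f := - lorentz (p n) u in f0 f1 *.
rewrite -!mulrA mulrCA ler_pM2l // /cosh.
have e4 : 4 <= expR 1 * expR 1 :> R by nra.
have E1 : expR (- (2 * (M + 2))) * expR (2 * M) <= 16^-1 :> R.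
  rewrite -expRD (_ : _ + _ = - 4); last by ring.
  rewrite expRN lef_pV2 ?posrE ?expR_gt0 //.
  rewrite (_ : 4 = 1 + 1 + (1 + 1)); last by ring.
  rewrite !expRD; nra.
have E2 : expR (- t) * expR (2 * M) <= expR t * 16^-1.
  have : expR (2 * M + 4) <= expR (t + t) by rewrite ler_expR; lra.
  rewrite (_ : 2 * M + 4 = 2 * M + (1 + 1 + (1 + 1))); last by ring.
  rewrite !expRD => hh; rewrite expRN ler_pdivrMl ?expR_gt0 //.
  have a16 : 16 <= expR 1 * expR 1 * (expR 1 * expR 1) :> R by nra.
  have E0 : 0 < expR (2 * M) by exact: expR_gt0.
  have : expR (2 * M) * 16 <= expR t * expR t.
    by apply: le_trans hh; rewrite ler_pM2l.
  lra.
have F1 : f * expR (2 * M) <= 4^-1.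
  apply: le_trans (_ : _ <= 4 * (expR (- (2 * (M + 2))) * expR (2 * M))) _.
    by rewrite mulrA ler_pM2r ?expR_gt0.
  lra.
have G1 : expR t * (f * expR (2 * M)) <= expR t * 4^-1 by rewrite ler_pM2l ?expR_gt0.
have G2 : 0 <= expR (- t) * expR (2 * M) * f by rewrite !mulr_ge0 ?expR_ge0.
have := expR_gt0 (- t); have := expR_gt0 t.
rewrite [leLHS](_ : _ = expR t * (f * expR (2 * M)) + 2 * (expR (- t) * expR (2 * M))
  - expR (- t) * expR (2 * M) * f); last by field.
lra.
Unshelve. all: by end_near. Qed.

End HyperbolicComplete.

(** * Trees and asymptotic cones *)

Section GeodesicTree.
Variables (R : realType) (X : metricType R).
Hypothesis tree : hyperbolic X 0.

Lemma tree_trans (m : R) (o x y z : X) :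
  m <= gromov o x y -> m <= gromov o y z -> m <= gromov o x z.
Proof. by move=> h1 h2; rewrite -[m]subr0; exact: tree h1 h2. Qed.

(** In a tree asymptotic rays merge: after the point where it leaves the way to
    [c 0] the ray [c'] moves away from [c 0] at unit speed, and so it coincides
    with [c] up to the shift [b]. *)
Lemma tree_rigid : ray_rigid X.
Proof.
move=> c c' /asboolP[M cM].
pose w := val c 0; pose w' := val c' 0; pose t1 := mdist w w'.
have t1_ge0 : 0 <= t1 by exact: mdist_ge0.
have M0 : 0 <= M by apply: le_trans (cM 0 (lexx 0)); rewrite mdist_ge0.
pose b := mdist (val c' t1) w - t1.
(* beyond [t1] the ray [c'] moves away from [w] at unit speed *)
have bE t : t1 <= t -> mdist (val c' t) w = t + b.
  move=> tt; have t0 : 0 <= t by lra.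
  have h0 : gromov w' (val c' t) (val c' t1) = t1.
    rewrite /gromov !ray_dist // !subr0 !ger0_norm ?subr_ge0 //; by field.
  have h1 : gromov w' w (val c' t) <= t1 by exact: gromov_le.
  have h2 : gromov w' w (val c' t1) <= t1 by exact: gromov_le.
  have h3 : gromov w' w (val c' t) <= gromov w' w (val c' t1).
    by apply: (@tree_trans _ _ _ (val c' t)) => //; rewrite h0.
  have h4 : gromov w' w (val c' t1) <= gromov w' w (val c' t).
    by apply: (@tree_trans _ _ _ (val c' t1)) => //; rewrite (gromovC w' (val c' t1)) h0.
  move: h3 h4; rewrite /gromov !ray_dist // !subr0 !ger0_norm //.
  by rewrite (metric_sym w (val c' t)) (metric_sym w (val c' t1)) /b; lra.
exists b => e e0; near=> t.
have tt1 : t1 <= t by near: t; apply: nbhs_pinfty_ge; exact: num_real.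
have t0 : 0 <= t by lra.
have tb : 0 <= t + b by rewrite -bE // mdist_ge0.
(* far enough for c s and c' s, at distance at most M, to be seen from w in
   the same direction up to time t + b *)
pose s := t + `|b| + M.
have [nb nb'] : b <= `|b| /\ - b <= `|b| by rewrite ler_norm -normrN ler_norm.
have s0 : 0 <= s by rewrite /s; lra.
have g1 : t + b <= gromov w (val c (t + b)) (val c s).
  rewrite /gromov !ray_dist // !subr0 (ger0_norm tb) (ger0_norm s0) distrC.
  by rewrite ger0_norm /s; lra.
have g2 : t + b <= gromov w (val c s) (val c' s).
  rewrite /gromov (bE s) ?ray_dist //; last by rewrite /s; lra.
  by rewrite subr0 (ger0_norm s0); have := cM s s0; rewrite /s; lra.
have g3 : t + b <= gromov w (val c' s) (val c' t).
  rewrite /gromov !bE //; last by rewrite /s; lra.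
  by rewrite ray_dist ?ger0_norm // /s; lra.
have := tree_trans (tree_trans g1 g2) g3.
rewrite /gromov bE // ray_dist // subr0 (ger0_norm tb); lra.
Unshelve. all: by end_near. Qed.

Hypothesis geod : geodesic_space X.

(** In a tree the geodesics from [o] to the points of a Gromov sequence
    eventually agree on any bounded interval, and the ray is their union. *)
Lemma tree_complete : gromov_complete X.
Proof.
move=> o x /choice[n0 xx].
have [g gP] := choice (fun n => geod o (x n)).
have g0 n : g n 0 = o by case: (gP n).
have gL n : g n (mdist o (x n)) = x n by case: (gP n).
have gd n s t : 0 <= s <= mdist o (x n) -> 0 <= t <= mdist o (x n) ->
    mdist (g n s) (g n t) = `|s - t| by case: (gP n) => _ _; apply.
have tL t n : (n0 t <= n)%N -> t <= mdist o (x n).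
  move=> nt; have := xx t n n nt nt; rewrite metric_sym => h.
  by apply: le_trans h (gromov_le _ _ _).
have go n t : 0 <= t -> (n0 t <= n)%N -> mdist (g n t) o = t.
  move=> t0 nt; rewrite -{1}(g0 n) gd ?subr0 ?ger0_norm ?lexx ?mdist_ge0 //.
  by rewrite t0 tL.
have gx n t : 0 <= t -> (n0 t <= n)%N -> gromov o (g n t) (x n) = t.
  move=> t0 nt; have tn : 0 <= t <= mdist o (x n) by rewrite t0 tL.
  have Ln : 0 <= mdist o (x n) <= mdist o (x n) by rewrite mdist_ge0 lexx.
  have := gd n t _ tn Ln; rewrite gL /gromov go // => ->.
  by rewrite distrC ger0_norm ?subr_ge0 ?tL // (metric_sym (x n)); field.
have gg n m t : 0 <= t -> (n0 t <= n)%N -> (n0 t <= m)%N -> g n t = g m t.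
  move=> t0 nt mt; apply/mdist_positivity/eqP; rewrite eq_le mdist_ge0 andbT.
  have h1 : t <= gromov o (g n t) (x n) by rewrite gx.
  have h2 : t <= gromov o (x m) (g m t) by rewrite gromovC gx.
  have := tree_trans (tree_trans h1 (xx t n m nt mt)) h2.
  by rewrite /gromov !go //; lra.
pose c t := g (n0 t) t.
have rc : `[< is_ray c >].
  apply/asboolP => s t s0 t0; pose n := maxn (n0 s) (n0 t).
  have ns : (n0 s <= n)%N by rewrite leq_maxl.
  have nt : (n0 t <= n)%N by rewrite leq_maxr.
  by rewrite /c (gg _ n s) // (gg _ n t) // gd ?s0 ?t0 ?tL.
exists (exist _ c rc) => M; exists (n0 M) => // n /= nM.
near=> t => /=.
have tM : M <= t by near: t; apply: nbhs_pinfty_ge; exact: num_real.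
have t0 : 0 <= t by near: t; exact: nbhs_pinfty_ge.
pose m := maxn (n0 t) (n0 M).
have mt : (n0 t <= m)%N by rewrite leq_maxl.
have mM : (n0 M <= m)%N by rewrite leq_maxr.
rewrite /c (gg _ m t) //; apply: (tree_trans (xx M n m nM mM)).
by rewrite gromovC gx.
Unshelve. all: by end_near. Qed.

End GeodesicTree.

Section ConvexSubset.
Variables (R : realType) (X : metricType R) (T : set X).

Lemma hyperbolic_subset delta : hyperbolic X delta -> hyperbolic T delta.
Proof. by move=> h m o x y z; exact: (h m (\val o) (\val x) (\val y) (\val z)). Qed.

Lemma geodesic_subset : geodesic_space X -> geodesically_convex T -> geodesic_space T.
Proof.
move=> geod conv x y; have [c [c0 cL cd]] := geod (\val x) (\val y).
have Tc t : 0 <= t <= mdist x y -> T (c t).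
  apply: conv => //; first exact: mdist_ge0.
    by rewrite c0; exact: set_mem (valP x).
  by rewrite cL; exact: set_mem (valP y).
pose f t : T := if pselect (T (c t)) is left h then exist _ (c t) (mem_set h) else x.
have fE t : 0 <= t <= mdist x y -> \val (f t) = c t.
  by move=> /Tc h; rewrite /f; case: pselect.
exists f; split=> [||s t hs ht].
- by apply/val_inj; rewrite fE ?c0 ?lexx ?mdist_ge0.
- by apply/val_inj; rewrite fE ?cL ?lexx ?mdist_ge0.
- by rewrite -(cd s t) // -!fE.
Qed.

End ConvexSubset.

Section ConeGeometry.
Variables (R : realType) (r : nat) (X : metricType R).
Variables (rho : nat -> isom_rep r X) (o : nat -> X).
Variables (omega : set_system nat) (UF : UltraFilter omega).
Local Notation C := (cone rho o UF).

Definition cone_lift (p : C) : nat -> X := val (repr p).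

Lemma cone_lift_cvg (p q : C) :
  rdist rho k (cone_lift p k) (cone_lift q k) @[k --> omega] --> mdist p q.
Proof. exact: admissible_cvg. Qed.

(** Geodesics of the cone are the limits of geodesics of [X] between representatives,
    parametrised proportionally on the interval of the limit length, so that the
    rescaled distances on them converge without any adjustment at the ends. *)
Lemma cone_geodesic : geodesic_space X -> geodesic_space C.
Proof.
move=> geod p q; have [pq|npq] := eqVneq p q.
  exists (fun=> p); split=> // s t; rewrite -pq mdistxx => s0 t0.
  have [-> ->] : s = 0 /\ t = 0 by lra.
  by rewrite subrr normr0.
have L0 : 0 < mdist p q.
  by rewrite lt_neqAle mdist_ge0 andbT eq_sym; apply: contra npq => /eqP/mdist_positivity->.
set L := mdist p q in L0 *.
have [g gP] := choice (fun k => geod (cone_lift p k) (cone_lift q k)).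
pose D k := mdist (cone_lift p k) (cone_lift q k).
have gd k s t : 0 <= s <= L -> 0 <= t <= L ->
    rdist rho k (g k (s / L * D k)) (g k (t / L * D k)) =
    `|s - t| / L * rdist rho k (cone_lift p k) (cone_lift q k).
  have D0 : 0 <= D k by exact: mdist_ge0.
  move=> /andP[s0 sL] /andP[t0 tL]; rewrite /rdist; case: (gP k) => _ _ ->.
  - rewrite -mulrBl -mulrBl !normrM (ger0_norm D0) (ger0_norm (x := L^-1)).
      by rewrite -/(D k); ring.
    by rewrite invr_ge0 ltW.
  - by rewrite mulr_ge0 ?divr_ge0 ?(ltW L0) // ler_piMl // ler_pdivrMr // mul1r.
  - by rewrite mulr_ge0 ?divr_ge0 ?(ltW L0) // ler_piMl // ler_pdivrMr // mul1r.
have adm t : 0 <= t <= L -> `[< admissible rho o omega (fun k => g k (t / L * D k)) >].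
  move=> tL; have t0 : (0 : R) <= 0 <= L by rewrite lexx ltW.
  have := @cone_lift_cvg p q => /cvgrPdist_le/(_ 1 ltr01) h.
  have /asboolP/admissibleP[M hM] := valP (repr p).
  apply/asboolP/admissibleP; exists (`|t - 0| / L * (L + 1) + M).
  apply: filterS (filterI h hM) => k [h1 h2].
  apply: le_trans (rdist_triangle _ _ (cone_lift p k) _ _) _.
  rewrite lerD // -[cone_lift p k](_ : g k (0 / L * D k) = _); last first.
    by rewrite !mul0r; case: (gP k).
  rewrite gd // ler_wpM2l ?divr_ge0 ?(ltW L0) //.
  by move: h1 => /ler_normlP[]; rewrite -/L; lra.
pose cs t (h : 0 <= t <= L) : cone_seq rho o omega :=
  exist _ (fun k => g k (t / L * D k)) (adm t h).
pose c t : C := if pselect (0 <= t <= L) is left h then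
  (\pi_C (cs t h))%qT else p.
have cE t (h : 0 <= t <= L) :
    c t = (\pi_C (cs t h))%qT.
  by rewrite /c; case: pselect => // h'; congr (\pi_C _)%qT; exact/val_inj.
have hL : 0 <= L <= L by rewrite lexx ltW.
have h0 : (0 : R) <= 0 <= L by rewrite lexx ltW.
exists c; split=> [||s t hs ht].
- rewrite (cE 0 h0) -[RHS]reprK; congr (\pi_C _)%qT; apply/val_inj/funext => k /=.
  by rewrite !mul0r; case: (gP k).
- rewrite (cE L hL) -[RHS]reprK; congr (\pi_C _)%qT; apply/val_inj/funext => k /=.
  by rewrite divff ?gt_eqF // mul1r; case: (gP k).
rewrite (cE s hs) (cE t ht) [LHS]cone_distE /seq_dist /=.
under eq_fun do rewrite gd //.
apply: cvg_lim => //.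
rewrite -[X in _ --> X](divfK (x := L)) ?gt_eqF //.
by apply: cvgM; [exact: cvg_cst|exact: cone_lift_cvg].
Qed.

(** Rescaling the metric by [1 / min_disp (rho k)] rescales the hyperbolicity
    constant, which tends to zero. *)
Lemma cone_tree delta : diverging rho -> nonprincipal omega -> 0 <= delta ->
  hyperbolic X delta -> hyperbolic C 0.
Proof.
move=> div np delta0 hyp m b x y z mxy myz; rewrite subr0.
apply/ler_addgt0Pr => e e0; have e4 : 0 < e / 4 by lra.
have gcv (p q : C) : \forall k \near omega,
    `|(min_disp (rho k))^-1 * gromov (cone_lift b k) (cone_lift p k) (cone_lift q k)
      - gromov b p q| <= e / 4.
  have h : (rdist rho k (cone_lift p k) (cone_lift b k)
      + rdist rho k (cone_lift q k) (cone_lift b k)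
      - rdist rho k (cone_lift p k) (cone_lift q k)) / 2 @[k --> omega] -->
      gromov b p q.
    apply: cvgM; last exact: cvg_cst.
    by apply: cvgB; [apply: cvgD|]; exact: cone_lift_cvg.
  move/cvgrPdist_le : h => /(_ _ e4); apply: filterS => k; rewrite distrC.
  congr (`|_ - _| <= _); rewrite /rdist /gromov.
  by set a := (min_disp _)^-1; field.
have rk : \forall k \near omega, 4 * delta / e + 1 <= min_disp (rho k).
  apply: nonprincipal_oo => //.
  by move/cvgryPge : div; apply.
have [k [[[h1 h2] h3] h4]] :=
  filter_ex (filterI (filterI (filterI (gcv x y) (gcv y z)) (gcv x z)) rk).
have rk0 : 0 < min_disp (rho k).
  by apply: lt_le_trans h4; rewrite ltr_wpDl // divr_ge0 ?mulr_ge0 // ltW.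
set a := min_disp (rho k) in h1 h2 h3 h4 rk0 *.
have da : a^-1 * delta <= e / 4.
  rewrite ler_pdivrMl //.
  have : 4 * delta / e <= a by lra.
  by rewrite ler_pdivrMr //; lra.
have hk := hyp ((m - e / 4) * a) (cone_lift b k)
  (cone_lift x k) (cone_lift y k) (cone_lift z k).
have h5 : (m - e / 4) * a <= gromov (cone_lift b k) (cone_lift x k) (cone_lift y k).
  rewrite -ler_pdivlMr // mulrC; move: h1 => /ler_normlP[]; lra.
have h6 : (m - e / 4) * a <= gromov (cone_lift b k) (cone_lift y k) (cone_lift z k).
  rewrite -ler_pdivlMr // mulrC; move: h2 => /ler_normlP[]; lra.
have {}hk := hk h5 h6.
have h7 : m - e / 4 - a^-1 * delta <=
    a^-1 * gromov (cone_lift b k) (cone_lift x k) (cone_lift z k).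
  rewrite -(ler_pM2l rk0) mulrBr !mulrA divff ?gt_eqF // !mul1r mulrC.
  exact: hk.
move: h3 => /ler_normlP[]; lra.
Qed.

End ConeGeometry.

(** * Comparison of the limit sets *)

Section OrbitLength.
Variables (R : realType) (r : nat) (X : metricType R).
Variables (rho : isom_rep r X) (o : X) (a : R) (a_gt0 : 0 < a).

Definition orbit_length (g : free_group r) : R := a * mdist o (rho g o).

Lemma orbit_length_gromov g h :
  len_gromov orbit_length g h = a * gromov o (rho g o) (rho h o).
Proof.
rewrite /len_gromov /orbit_length /gromov.
have -> : mdist o (rho (g^-1 * h)%g o) = mdist (rho g o) (rho h o).
  by rewrite -(rep_isom rho g) -repM mulgA mulgV mul1g.
by rewrite (metric_sym o) (metric_sym o (rho h o)); field.
Qed.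

Lemma orbit_hyp_length delta :
  hyperbolic X delta -> hyp_length orbit_length (a * delta).
Proof.
move=> hyp; split.
- by rewrite /orbit_length rep1 mdistxx mulr0.
- move=> g; rewrite /orbit_length -(rep_isom rho g o) -repM mulgV rep1.
  by rewrite metric_sym.
- move=> g h; rewrite /orbit_length -mulrDr ler_pM2l // repM.
  by have := metric_triangle o (rho g o) (rho g (rho h o)); rewrite rep_isom.
move=> m f g h; rewrite !orbit_length_gromov => h1 h2.
have a0 : a != 0 by rewrite gt_eqF.
have -> : m - a * delta = a * (m / a - delta) by rewrite mulrBr mulrCA divff // mulr1.
rewrite ler_pM2l //; apply: (hyp _ _ _ (rho g o)); by rewrite ler_pdivrMr // mulrC.
Qed.

End OrbitLength.

Section LengthLimit.
Variables (R : realType) (r : nat) (X : metricType R).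
Variables (rho : nat -> isom_rep r X) (div_rho : diverging rho) (o : nat -> X).
Hypothesis disp_o : forall k, joint_disp (rho k) (o k) <= min_disp (rho k) + 1.
Variables (omega : set_system nat) (UF : UltraFilter omega).
Hypothesis np_omega : nonprincipal omega.

(** The distance in the cone between the base point and its image is by definition
    the limit of the rescaled distances between the representatives. *)
Lemma orbit_length_cvg g :
  orbit_length (rho k) (o k) (min_disp (rho k))^-1 g @[k --> omega] -->
  mdist (cone_base rho o UF)
        (cone_rep UF div_rho disp_o np_omega g (cone_base rho o UF)).
Proof.
pose o' : cone_seq rho o omega := exist _ o (base_admissible rho o UF).
have -> : cone_rep UF div_rho disp_o np_omega g (cone_base rho o UF) =
    (\pi_(cone rho o UF) (seq_act UF div_rho disp_o np_omega g o'))%qT.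
  exact: cone_actE.
rewrite [mdist _ _](cone_distE UF o' (seq_act UF div_rho disp_o np_omega g o')).
exact: (@admissible_cvg _ _ _ _ _ _ UF o' (seq_act UF div_rho disp_o np_omega g o')).
Qed.

End LengthLimit.

Lemma near_short_words (r : nat) (omega : set_system nat) (L : nat)
    (P : nat -> seq (letter r) -> Prop) : Filter omega ->
  (forall w, \forall k \near omega, P k w) ->
  \forall k \near omega, forall w, (size w <= L)%N -> P k w.
Proof.
move=> FF h.
have : \forall k \near omega, forall w : L.-bseq ('I_r * bool)%type, P k w.
  by apply: filter_forall => w; exact: h.
by apply: filterS => k hk w sw; exact: (hk (Bseq sw)).
Qed.

(** Sets of the ultrafilter are infinite, so that one can choose an index for each
    condition beyond the previous ones. *)
Lemma ultra_subsequence (omega : set_system nat) (G : nat -> nat -> Prop) :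
  UltraFilter omega -> nonprincipal omega ->
  (forall n, \forall k \near omega, G n k) ->
  exists2 phi : nat -> nat, {homo phi : i j / (i < j)%N} & forall n, G n (phi n).
Proof.
move=> UF np hG.
have ex (nm : nat * nat) : exists k, (nm.2 <= k)%N /\ G nm.1 k.
  have h : \forall k \near omega, (nm.2 <= k)%N.
    by apply: nonprincipal_oo => //; exists nm.2.
  by have [k [h1 h2]] := filter_ex (filterI h (hG nm.1)); exists k.
have [f hf] := choice ex.
pose phi := fix phi n := if n is m.+1 then f (m.+1, (phi m).+1) else f (0%N, 0%N).
exists phi; last by case=> [|n]; [case: (hf (0, 0)%N)|case: (hf (n.+1, (phi n).+1))].
apply: homo_ltn => [i j k|i]; first exact: ltn_trans.
by case: (hf (i.+1, (phi i).+1)).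
Qed.

Lemma ereal_squeeze (R : realType) (D : \bar R) (a : nat -> \bar R) :
  (0 <= D)%E -> (forall n, (0 <= a n)%E) ->
  (forall n, ((1 - n.+2%:R^-1)%:E * a n <= D)%E /\
             (D <= (1 + n.+2%:R^-1)%:E * a n)%E) ->
  a n @[n --> \oo] --> D.
Proof.
move=> D0 a0 h.
have e2 n : n.+2%:R^-1 <= 2^-1 :> R by rewrite lef_pV2 ?posrE // ler_nat.
have e0 n : 0 < n.+2%:R^-1 :> R by rewrite invr_gt0.
case: D D0 h => [d||] // D0 h; last first.
  apply: cvg_near_cst; apply: nearW => n; have [_] := h n.
  rewrite leye_eq; case: (a n) (a0 n) => [x||] // _.
have d0 : 0 <= d by rewrite -lee_fin.
have fin n : exists2 x, a n = x%:E & 0 <= x <= 2 * d.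
  have [+ _] := h n; case: (a n) (a0 n) => [x||] //; last first.
    by rewrite gt0_muley ?leye_eq // lte_fin subr_gt0; apply: le_lt_trans (e2 n) _; lra.
  rewrite lee_fin => x0; rewrite -EFinM lee_fin => hx; exists x => //.
  move: (e2 n) hx; rewrite x0; set z := _^-1 => z2 hx /=.
  have : 0 <= x * (2^-1 - z) by rewrite mulr_ge0 // subr_ge0.
  by rewrite mulrBr; rewrite mulrBl mul1r mulrC in hx; lra.
apply/fine_cvgP; split; first by apply: nearW => n; have [x ->] := fin n.
apply/cvgrPdist_le => e epos.
have cv : (2 * d) * harmonic n @[n --> \oo] --> (2 * d) * 0.
  by apply: cvgM; [exact: cvg_cst|exact: cvg_harmonic].
move/cvgrPdist_le : cv => /(_ e epos); apply: filterS => n /=.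
rewrite mulr0 sub0r normrN /harmonic => hn; have [x ax /andP[x0 x2]] := fin n.
have [] := h n; rewrite ax -!EFinM !lee_fin /= => h1 h2.
apply: le_trans hn; rewrite [leRHS]ger0_norm ?mulr_ge0 ?invr_ge0 //.
have i1 : n.+2%:R^-1 <= n.+1%:R^-1 :> R by rewrite lef_pV2 ?posrE // ler_nat.
move: (e0 n) h1 h2 i1; set z := n.+2%:R^-1; set z1 := n.+1%:R^-1 => i2 h1 h2 i1.
have : x * z <= 2 * d * z1.
  by apply: ler_pM => //; exact: ltW.
rewrite mulrBl mul1r in h1; rewrite mulrDl mul1r in h2; rewrite (mulrC x) => i3.
by apply/ler_normlP; split; lra.
Qed.
Section CompareActions.
Variables (R : realType) (r : nat) (X Y : metricType R).
Variables (rhoX : isom_rep r X) (oX : X) (rhoY : isom_rep r Y) (oY : Y).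
Variables (deltaX deltaY s e C : R).
Hypotheses (hypX : hyperbolic X deltaX) (hypY : hyperbolic Y deltaY).
Hypotheses (deltaX_ge0 : 0 <= deltaX) (deltaY_ge0 : 0 <= deltaY).
Hypotheses (rigidX : ray_rigid X) (rigidY : ray_rigid Y).
Hypotheses (completeX : gromov_complete X) (completeY : gromov_complete Y).
Hypotheses (s_gt0 : 0 < s) (e_gt0 : 0 < e) (e_lt1 : e < 1).
Let DX := orbit_length rhoX oX 1.
Let DY := orbit_length rhoY oY s^-1.
Hypothesis close : forall g h,
  `|len_gromov DY g h - len_gromov DX g h| <= e * len_gromov DX g h + C.

Let HX := Hdim (visual_dist oX) (limit_set rhoX oX).
Let HY := Hdim (visual_dist oY) (limit_set rhoY oY).

(** Both directions come from [Hdim_orbit_limit_le]; the factor [s] undoes the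
    normalisation of the metric of [Y] in the length function [DY]. *)
Lemma Hdim_compare_actions :
  ((1 - e)%:E * (s%:E * HY) <= HX)%E /\ (HX <= (1 + e)%:E * (s%:E * HY))%E.
Proof.
have [e0 e1 s0] := And3 e_gt0 e_lt1 s_gt0.
have sn0 : s != 0 by rewrite gt_eqF.
have en0 : 1 + e != 0 by rewrite gt_eqF //; lra.
have a0 : 0 < s * (1 - e) by rewrite mulr_gt0 //; lra.
have b0 : 0 < (s * (1 + e))^-1 by rewrite invr_gt0 mulr_gt0 //; lra.
have lowY g h : s * (1 - e) * gromov oX (rhoX g oX) (rhoX h oX) - s * C <=
    gromov oY (rhoY g oY) (rhoY h oY).
  have /ler_normlP[+ _] := close g h.
  rewrite !orbit_length_gromov mul1r.
  move: (gromov oX _ _) (gromov oY _ _) => x y h1.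
  rewrite -(ler_pM2l (x := s^-1)) ?invr_gt0 // mulrBr !mulrA mulVf // !mul1r.
  by move: h1; rewrite mulrBl mul1r; lra.
have lowX g h : (s * (1 + e))^-1 * gromov oY (rhoY g oY) (rhoY h oY) - C / (1 + e) <=
    gromov oX (rhoX g oX) (rhoX h oX).
  have /ler_normlP[_] := close g h.
  rewrite !orbit_length_gromov mul1r.
  move: (gromov oX _ _) (gromov oY _ _) => x y h1.
  rewrite invfM mulrAC -mulrBl ler_pdivrMr; last by lra.
  by move: h1; rewrite mulrDr mulr1 (mulrC _ e); lra.
have h1 := Hdim_orbit_limit_le hypX hypY deltaX_ge0 deltaY_ge0 rigidX rigidY
  completeX a0 b0 lowY lowX.
have h2 := Hdim_orbit_limit_le hypY hypX deltaY_ge0 deltaX_ge0 rigidY rigidX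
  completeY b0 a0 lowX lowY.
split; first by rewrite muleA -EFinM mulrC; exact: h1.
rewrite muleA -EFinM (mulrC (1 + e)) -lee_pdivrMl //.
by rewrite mulr_gt0 //; lra.
Qed.

End CompareActions.

Lemma Hdim_ge0 (R : realType) (E : Type) (d : E -> E -> \bar R) A : (0 <= Hdim d A)%E.
Proof. by apply: le_ereal_inf_tmp => _ [s [s0 _] <-]; rewrite lee_fin ltW. Qed.

Theorem theorem1p3 (R : realType) (N r : nat) (N_ge1 : (1 <= N)%N) (r_ge2 : (2 <= r)%N)
    (rho : nat -> isom_rep r (hyp R N)) (div_rho : diverging rho)
    (o : nat -> hyp R N)
    (disp_o : forall k, joint_disp (rho k) (o k) <= min_disp (rho k) + 1)
    (omega : set_system nat) (UF : UltraFilter omega)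
    (np_omega : nonprincipal omega)
    (T : set (cone rho o UF))
    (minT : minimal_subtree (cone_rep UF div_rho disp_o np_omega) T)
    (oT : T) (oTE : \val oT = cone_base rho o UF)
    (rho_inf_schottky : schottky (tree_rep minT) oT) :
  exists2 phi : nat -> nat, {homo phi : i j / (i < j)%N} &
    ((min_disp (rho (phi k)))%:E *
       Hdim (visual_dist (o (phi k))) (limit_set (rho (phi k)) (o (phi k))))%E
      @[k --> \oo] -->
    Hdim (visual_dist oT) (limit_set (tree_rep minT) oT).
Proof.
have T_tree : hyperbolic T 0.
  apply: hyperbolic_subset.
  exact: cone_tree div_rho np_omega (hyp_delta_ge0 R) (@hyp_hyperbolic R N).
have T_geod : geodesic_space T.
  apply: geodesic_subset; first exact/cone_geodesic/hyp_geodesic.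
  by have [[]] := minT.
pose D := orbit_length (tree_rep minT) oT 1.
have lD : hyp_length D 0 by rewrite -[0](mulr0 1); exact: orbit_hyp_length.
have [K K1 schot] := rho_inf_schottky.
have DE g : D g = mdist (tree_rep minT 1%g oT) (tree_rep minT g oT).
  by rewrite /D /orbit_length mul1r rep1.
have len_lb g : K^-1 * (word_length g)%:R - K <= D g.
  by rewrite DE; have [+ _] := schot 1%g g; rewrite invg1 mul1g.
have len_ub g : D g <= K * (word_length g)%:R + K.
  by rewrite DE; have [_] := schot 1%g g; rewrite invg1 mul1g.
have [L L0 L_big] := tree_scale K1.
pose len k := orbit_length (rho k) (o k) (min_disp (rho k))^-1.
have len_cvg g : len k g @[k --> omega] --> D g.
  have := @orbit_length_cvg _ _ _ _ div_rho _ disp_o _ UF np_omega g.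
  by rewrite -oTE /D /orbit_length mul1r.
pose eps n : R := n.+2%:R^-1; pose eta n := eps n / (6 * K).
have eps_gt0 n : 0 < eps n by rewrite invr_gt0.
have eps_lt1 n : eps n < 1 by rewrite invf_lt1 ?ltr1n.
have K0 : 0 < K by lra.
have eta_gt0 n : 0 < eta n by rewrite divr_gt0 // mulr_gt0.
have eta_le1 n : eta n <= 1.
  rewrite ler_pdivrMr ?mulr_gt0 // mul1r; have := eps_lt1 n; lra.
pose good n k := [/\ 0 < min_disp (rho k),
  (min_disp (rho k))^-1 * hyp_delta R <= eta n & forall w, (size w <= 2 * L)%N ->
    `|len k (fg_of w) - D (fg_of w)| <= eta n].
have goodP n : \forall k \near omega, good n k.
  have h1 : \forall k \near omega, hyp_delta R / eta n + 1 <= min_disp (rho k).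
    apply: nonprincipal_oo => //.
    by have /cvgryPge := div_rho; apply.
  have h2 : \forall k \near omega, forall w, (size w <= 2 * L)%N ->
      `|len k (fg_of w) - D (fg_of w)| <= eta n.
    apply: near_short_words => w; have /cvgrPdist_le/(_ _ (eta_gt0 n)) := len_cvg (fg_of w).
    by apply: filterS => k; rewrite distrC.
  apply: filterS (filterI h1 h2) => k [hk hw].
  have h0 : 0 <= hyp_delta R / eta n.
    by rewrite divr_ge0 ?hyp_delta_ge0 // ltW.
  have rk0 : 0 < min_disp (rho k) by lra.
  split=> //; rewrite ler_pdivrMl // -ler_pdivrMr //; lra.
have [phi phi_incr phi_good] := ultra_subsequence UF np_omega goodP.
exists phi => //; apply: ereal_squeeze => [|n|n]; first exact: Hdim_ge0.
  by rewrite mule_ge0 ?Hdim_ge0 // lee_fin min_disp_ge0.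
have [rk0 small close] := phi_good n; set k := phi n in rk0 small close *.
have lk : hyp_length (len k) ((min_disp (rho k))^-1 * hyp_delta R).
  by apply: orbit_hyp_length; [rewrite invr_gt0|exact: hyp_hyperbolic].
have delta0 : 0 <= (min_disp (rho k))^-1 * hyp_delta R.
  by rewrite mulr_ge0 ?hyp_delta_ge0 // invr_ge0 ltW.
have close' w : reduced w -> (size w <= 2 * L)%N ->
    `|len k (fg_of w) - D (fg_of w)| <= eta n by move=> _; exact: close.
have gc := gromov_close lD K1 len_lb len_ub L0 L_big lk delta0 small (eta_le1 n) close'.
rewrite (_ : 6 * K * eta n = eps n) in gc; last by rewrite /eta; field; rewrite gt_eqF.
apply: (Hdim_compare_actions T_tree (@hyp_hyperbolic R N) (lexx 0) (hyp_delta_ge0 R)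
  (tree_rigid T_tree) (@hyp_rigid R N) (tree_complete T_tree T_geod)
  (@hyp_complete R N) rk0 (eps_gt0 n) (eps_lt1 n) gc).
Qed.
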